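(* Let $h\ge 0$. If $x:[0,+\infty)\to\Omega$ is a free time minimizer of the action functional $\mathcal{A}_h$ of the Newtonian $N$-body problem, with center of mass at rest, then $x$ is a geodesic ray of the Jacobi-Maupertuis metric $j_h$.
   Context: Let $E$ be a (finite-dimensional) Euclidean space, $N\ge 2$, and let $m_1,\dots,m_N>0$ be masses. A configuration is $x=(r_1,\dots,r_N)\in E^N$; write $r_{ij}=\|r_i-r_j\|$. $\Omega\subset E^N$ is the open dense set of configurations without collisions, i.e. with $r_i\ne r_j$ whenever $i\neq j$. The Newtonian potential is $U(x)=\sum_{i<j}m_im_j/r_{ij}$ (equal to $+\infty$ outside $\Omega$), and $E^N$ carries the flat metric $g_m$ given by the mass inner product, with norm $\|v\|^2=\sum_i m_i\|v_i\|^2$. The Lagrangian is $L(x,v)=\frac12\|v\|^2+U(x)\in\mathbb{R}\cup\{+\infty\}$. For $h\ge 0$ and an absolutely continuous curve $\gamma:[a,b]\to E^N$, set $\mathcal{A}_h(\gamma)=\int_a^b L(\gamma(t),\dot\gamma(t))\,dt+h(b-a)$. For $x,y\in E^N$ let $\phi_h(x,y)$ be the infimum of $\mathcal{A}_h(\gamma)$ over all $\tau>0$ and all absolutely continuous $\gamma:[0,\tau]\to E^N$ with $\gamma(0)=x$, $\gamma(\tau)=y$ (the time $\tau$ is free, and competing curves may pass through collisions). A curve $x:[0,+\infty)\to\Omega$ (absolutely continuous on compact intervals) is a free time minimizer of $\mathcal{A}_h$ if $\mathcal{A}_h(x|_{[a,b]})=\phi_h(x(a),x(b))$ for every compact interval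 $[a,b]\subset[0,+\infty)$. The Jacobi-Maupertuis metric of energy level $h\geq 0$ is the Riemannian metric $j_h=2(h+U)\,g_m$ on $\Omega$. A curve $x:[0,+\infty)\to\Omega$ is a geodesic ray for $j_h$ if its arclength parameterization (with respect to $j_h$) is an isometric embedding of the half-line $[0,+\infty)$ into $(\Omega,j_h)$; that is, $x$ has infinite $j_h$-length and the arclength parameterization is a geodesic all of whose restrictions to compact subintervals are minimizing. Center of mass at rest means that, writing $x(t)=(r_1(t),\dots,r_N(t))$, the vector $\sum_i m_i r_i(t)$ is constant in $t$. *)

(* Defs.v *)
(* MathComp-Analysis development.
   The Euclidean space E is R^d, with vectors 'rV[R]_d; a configuration
   x = (r_1, ..., r_N) in E^N is the matrix 'M[R]_(N, d) whose i-th row is r_i. *)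
From HB Require Import structures.
From mathcomp Require Import all_boot all_order all_algebra.
From mathcomp Require Import all_classical all_reals all_analysis.

Set Implicit Arguments.
Unset Strict Implicit.
Unset Printing Implicit Defensive.

Import Order.TTheory GRing.Theory Num.Theory.
Import numFieldNormedType.Exports.

Local Open Scope classical_set_scope.
Local Open Scope ring_scope.

Section Curves.
Context {R : realType} {V : normedModType R}.

(* The intervals [u i, v i] may be degenerate. For V a space of matrices `|_|
   is the sup norm, which defines the same notion as any other norm. *)
Definition abs_continuous (f : R -> V) (a b : R) : Prop :=
  forall e : R, 0 < e -> exists2 δ : R, 0 < δ &
    forall (n : nat) (u v : 'I_n -> R),
      (forall i, a <= u i /\ u i <= v i /\ v i <= b) ->
      (forall i j, i != j -> v i <= u j \/ v j <= u i) ->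
      \sum_(i < n) (v i - u i) < δ ->
      \sum_(i < n) `|f (v i) - f (u i)| < e.

(* A C^1 curve on a compact interval (with one-sided derivatives at the
   endpoints) is the restriction of a C^1 curve defined on R. Continuity of f
   on [a, b] holds because consecutive closed pieces share an endpoint. *)
Definition piecewise_C1 (f : R -> V) (a b : R) : Prop :=
  exists (n : nat) (t : nat -> R),
    [/\ t 0%N = a, t n = b,
        forall i, (i < n)%N -> t i < t i.+1 &
        forall i, (i < n)%N -> exists g : R -> V,
          [/\ forall s, derivable g s 1,
              continuous (derive1 g) &
              forall s, t i <= s <= t i.+1 -> f s = g s]].

End Curves.

Section NBody.
Context {R : realType} {N d : nat}.
Implicit Types (m : 'I_N -> R) (x v w p q : 'M[R]_(N, d)) (γ : R -> 'M[R]_(N, d)).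

Definition dotp (u v : 'rV[R]_d) : R := \sum_(k < d) u 0 k * v 0 k.

Definition enorm (u : 'rV[R]_d) : R := Num.sqrt (dotp u u).

Definition dist_ij x (i j : 'I_N) : R := enorm (row i x - row j x).

Definition Omega : set 'M[R]_(N, d) :=
  [set x | forall i j : 'I_N, i != j -> row i x != row j x].

Definition newton_sum m x : R :=
  \sum_(i < N) \sum_(j < N | (i < j)%N) m i * m j / dist_ij x i j.

Definition potential m x : \bar R :=
  if `[< Omega x >] then (newton_sum m x)%:E else +oo%E.

Definition mass_dot m v w : R := \sum_(i < N) m i * dotp (row i v) (row i w).

Definition mass_norm m v : R := Num.sqrt (mass_dot m v v).

Definition lagrangian m x v : \bar R :=
  ((mass_norm m v ^+ 2 / 2)%:E + potential m x)%E.

(* The derivative of an absolutely continuous curve exists almost everywhere;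
   where it does not exist (in particular, possibly, at a and b, since γ is
   unconstrained outside [a, b]) derive1 γ takes a junk value on a null set. *)
Definition action m (h : R) γ (a b : R) : \bar R :=
  (\int[lebesgue_measure]_(t in `[a, b]) lagrangian m (γ t) (derive1 γ t)
   + (h * (b - a))%:E)%E.

Definition action_potential m (h : R) x y : \bar R :=
  ereal_inf [set A | exists (τ : R) (γ : R -> 'M[R]_(N, d)),
    [/\ 0 < τ, abs_continuous γ 0 τ, γ 0 = x, γ τ = y & A = action m h γ 0 τ]].

(* Curves [0, +oo) -> Omega are functions on R considered only at t >= 0. *)
Definition curve_in_Omega γ : Prop :=
  (forall t, 0 <= t -> Omega (γ t)) /\
  (forall a b, 0 <= a -> a <= b -> abs_continuous γ a b).

Definition free_time_minimizer m (h : R) γ : Prop :=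
  curve_in_Omega γ /\
  (forall a b, 0 <= a -> a <= b ->
     action m h γ a b = action_potential m h (γ a) (γ b)).

Definition center_of_mass_at_rest m γ : Prop :=
  forall s t, 0 <= s -> 0 <= t ->
    \sum_(i < N) m i *: row i (γ s) = \sum_(i < N) m i *: row i (γ t).

(* Only meaningful for x in Omega, where newton_sum m x is U(x). *)
Definition jm_metric m (h : R) x v w : R :=
  2 * (h + newton_sum m x) * mass_dot m v w.

Definition jm_length m (h : R) γ (I : set R) : \bar R :=
  (\int[lebesgue_measure]_(t in I)
     (Num.sqrt (jm_metric m h (γ t) (derive1 γ t) (derive1 γ t)))%:E)%E.

(* Riemannian distance of (Omega, j_h); it is +oo between distinct connected
   components of Omega, which exist when d = 1. *)
Definition jm_dist m (h : R) p q : \bar R :=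
  ereal_inf [set l | exists (a b : R) (γ : R -> 'M[R]_(N, d)),
    [/\ a < b, γ a = p /\ γ b = q, piecewise_C1 γ a b,
        forall t, a <= t <= b -> Omega (γ t) &
        l = jm_length m h γ `[a, b]]].

Definition arclength m (h : R) γ (t : R) : R := fine (jm_length m h γ `[0, t]).

(* As arclength maps [0, +oo) onto [0, +oo), the arclength parameterization σ
   is determined on [0, +oo) by γ = σ \o arclength. *)
Definition geodesic_ray m (h : R) γ : Prop :=
  [/\ curve_in_Omega γ,
      forall t, 0 <= t -> (jm_length m h γ `[0%R, t] < +oo)%E,
      jm_length m h γ `[0%R, +oo[ = +oo%E &
      exists σ : R -> 'M[R]_(N, d),
        [/\ forall t, 0 <= t -> γ t = σ (arclength m h γ t),
            forall s, 0 <= s -> Omega (σ s) &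
            forall s s', 0 <= s -> 0 <= s' ->
              jm_dist m h (σ s) (σ s') = `|s - s'|%:E]].

End NBody.

(* Main.v *)
(* Write L(γ) for the j_h-length. By AM-GM, sqrt (2 (h + U)) |v| <= |v|^2 / 2 + U + h,
   so L <= A_h. Conversely, a curve γ in Omega is approximated by polygons run at
   energy h, whose action is at most L(γ) + e, because the length of a chord is
   bounded by the integral of the speed. As these polygons are piecewise C^1,
   d <= L and, applied to the competitors of the Riemannian distance d, this
   yields phi_h <= d. For a minimizer x this closes the chain
   L(x) <= A_h(x) = phi_h <= d <= L(x) on every compact interval. The length of x
   is infinite since otherwise A_h(x) would be bounded on [0, T] uniformly in T.
   As x is only absolutely continuous, the chord estimate requires the Lebesgue
   fundamental theorem of calculus: the total variation of an absolutely continuous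
   function defines a Stieltjes measure dominated by the Lebesgue measure, and the
   Radon-Nikodym density is the derivative almost everywhere. *)
Require Import Defs.
From HB Require Import structures.
From mathcomp Require Import all_boot all_order all_algebra.
From mathcomp Require Import all_classical all_reals all_analysis.
From mathcomp Require Import measurable_realfun ring lra.

Set Implicit Arguments.
Unset Strict Implicit.
Unset Printing Implicit Defensive.

Import Order.TTheory GRing.Theory Num.Theory.
Import numFieldNormedType.Exports.

Local Open Scope classical_set_scope.
Local Open Scope ring_scope.

(** * Absolutely continuous functions *)

(** The infimum [action_potential] ranges over curves that may cross collisions, but it is only ever
    bounded from above, by actions of polygons inside [Omega]; colliding competitors never have to
    be examined. Polygons are preferred to a reparametrization at energy [h] for two reasons: the
    arclength of an absolutely continuous curve can be constant on intervals or have an inverse that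
    is not absolutely continuous, and [jm_dist] admits piecewise C^1 competitors only. One polygon
    serves twice, because its action also bounds its length; [reachable] records just such polygons
    and their concatenations. Another obstacle is that [derive1] of a curve is not known to be
    measurable. Actions and lengths are therefore rewritten with a measurable speed [sp], equal to
    the true one off a null set, before any additivity of integrals is invoked. *)

Lemma interval_induction (R : realType) (P : R -> R -> Prop) (a b : R) :
  a < b ->
  (forall s t u, a <= s -> s < t -> t < u -> u <= b -> P s t -> P t u -> P s u) ->
  (forall c, a <= c -> c <= b -> exists2 e, 0 < e &
     forall s t, a <= s -> s <= c -> c <= t -> t <= b -> s < t -> t - s < e ->
       P s t) ->
  P a b.
Proof.
move=> ab Padd Ploc.
(* Continuous induction, in place of a finite subdivision by compactness: the local property at
   [sup S] glues a point of [S] just before it to a point just after it, which forces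
   [sup S = b]. *)
pose S := [set t | [/\ a < t, t <= b & P a t]].
have [e0 e0_gt0 P0] := Ploc a (lexx _) (ltW ab).
have S0 : exists2 t, S t & t - a <= e0 / 2.
  exists (Num.min b (a + e0 / 2)); last first.
    by rewrite lerBlDl ge_min lexx orbT.
  have h1 : a < Num.min b (a + e0 / 2) by rewrite lt_min ab ltrDl divr_gt0.
  have h2 : Num.min b (a + e0 / 2) <= b by rewrite ge_min lexx.
  split => //; apply: P0 => //; [exact: ltW|].
  apply: (@le_lt_trans _ _ (e0 / 2)); last lra.
  by rewrite lerBlDl ge_min lexx orbT.
have supS : has_sup S.
  split; first by case: S0 => t St _; exists t.
  by exists b => t [].
pose c := sup S.
have Sc t : S t -> t <= c by move=> St; apply: ub_le_sup => //; case: supS.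
have cb : c <= b by apply: ge_sup; [case: supS|move=> t []].
have ac : a < c by case: S0 => t /[dup] /Sc tc [at_ _ _] _; exact: lt_le_trans tc.
have [e e_gt0 Pe] := Ploc c (ltW ac) cb.
have e2 : 0 < e / 2 by rewrite divr_gt0.
have [t [at_ tb Pat] ct] := sup_adherent e2 supS.
have tc : t <= c by exact: Sc.
rewrite -/c in ct.
(* Since [c - e / 2 < t], the interval from [t] to [t'] is shorter than [e] and contains [c]. *)
pose t' := Num.min b (c + e / 4).
have ct' : c <= t' by rewrite le_min cb lerDl; lra.
have t'b : t' <= b by rewrite ge_min lexx.
have t'e : t' <= c + e / 4 by rewrite ge_min lexx orbT.
have Pat' : P a t'.
  have [tt'|] := ltP t t'.
    apply: (Padd a t t') => //; apply: Pe => //; first exact: ltW.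
    lra.
  move=> t't; suff <- : t = t' by [].
  by apply/eqP; rewrite eq_le t't (le_trans tc).
have := Sc t' (And3 (lt_le_trans ac ct') t'b Pat').
rewrite /t' in ct' t'b t'e Pat' *.
case: (leP b (c + e / 4)) Pat' => // _ _ cc; exfalso; lra.
Qed.

(** The pair [e], [δ] is made explicit because the same [δ] has to be reused for refinements of a
    family of intervals. *)
Definition ac_modulus (R : realType) (V : normedModType R) (f : R -> V)
    (a b e δ : R) : Prop :=
  forall (n : nat) (u v : 'I_n -> R),
    (forall i, a <= u i /\ u i <= v i /\ v i <= b) ->
    (forall i j, i != j -> v i <= u j \/ v j <= u i) ->
    \sum_(i < n) (v i - u i) < δ ->
    \sum_(i < n) `|f (v i) - f (u i)| < e.

Lemma ac_modulus_fin (R : realType) (V : normedModType R) (f : R -> V)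
    (a b e δ : R) (I : finType) (u v : I -> R) :
  ac_modulus f a b e δ ->
  (forall i, a <= u i /\ u i <= v i /\ v i <= b) ->
  (forall i j, i != j -> v i <= u j \/ v j <= u i) ->
  \sum_i (v i - u i) < δ -> \sum_i `|f (v i) - f (u i)| < e.
Proof.
move=> fac uv disj.
rewrite (big_enum_val (A := I)) [X in _ -> X < _](big_enum_val (A := I)) /= => sum_lt.
apply: fac => // i j ij; apply: disj; apply: contra ij => /eqP/enum_val_inj ->//.
Qed.

(** Refining the intervals keeps them non-overlapping and, by telescoping, keeps their total length,
    so the same [δ] applies. A common number [M] of pieces lets pairs index the refined family;
    degenerate pieces serve as padding. *)
Lemma ac_modulus_grid (R : realType) (V : normedModType R) (f : R -> V)
    (a b e δ : R) (n M : nat) (F : 'I_n -> nat -> R) :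
  ac_modulus f a b e δ ->
  (forall i, {homo F i : j k / (j <= k)%N >-> j <= k}) ->
  (forall i, a <= F i 0%N) -> (forall i, F i M <= b) ->
  (forall i j, i != j -> F i M <= F j 0%N \/ F j M <= F i 0%N) ->
  \sum_(i < n) (F i M - F i 0%N) < δ ->
  \sum_(i < n) \sum_(k < M) `|f (F i k.+1) - f (F i k)| < e.
Proof.
move=> fac ndF aF Fb disj sum_lt; rewrite pair_big /=.
apply: (ac_modulus_fin (u := fun p : 'I_n * 'I_M => F p.1 p.2)
  (v := fun p : 'I_n * 'I_M => F p.1 p.2.+1) fac).
- move=> [i k] /=; split; first by rewrite (le_trans (aF i))// ndF.
  by split; [rewrite ndF|rewrite (le_trans _ (Fb i))// ndF].
- move=> [i k] [j l] /= ij.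
  have [eij|neij] := eqVneq i j; last first.
    have [h|h] := disj _ _ neij; [left|right].
      by rewrite (le_trans _ (ndF j 0%N l _))// (le_trans _ h)// ndF.
    by rewrite (le_trans _ (ndF i 0%N k _))// (le_trans _ h)// ndF.
  move: ij; rewrite -eij xpair_eqE eqxx /= => kl.
  have /orP[lkl|lkl] : (k < l)%N || (l < k)%N by rewrite -neq_ltn.
    by left; rewrite ndF.
  by right; rewrite ndF.
- rewrite -(pair_big xpredT xpredT
    (fun (i : 'I_n) (k : 'I_M) => F i k.+1 - F i k)) /=.
  under eq_bigr => i _.
    rewrite -(big_mkord xpredT (fun k => F i k.+1 - F i k)) telescope_sumr//.
    over.
  by [].
Qed.

(** The default value [b] continues the partition constantly past its end, so that partitions of
    different sizes can be padded to a common one. *)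
Lemma itv_partition_nth_homo (R : realType) (a b : R) (s : seq R) :
  itv_partition a b s ->
  {homo nth b (a :: s) : j k / (j <= k)%N >-> j <= k}.
Proof.
move=> abs; apply: (homo_leq (r := fun x y : R => x <= y)) => [//|y x z|k].
  exact: le_trans.
have [ks|sk] := ltnP k (size s).
  exact: (@nondecreasing_fun_itv_partition _ _ a b id s).
rewrite [leRHS]nth_default//=.
move: sk; rewrite leq_eqVlt => /predU1P[<-|sk].
  by rewrite (itv_partition_nth_size b abs).
by rewrite nth_default.
Qed.

(** Each [A i] is bounded by [e]: complete one of its elements by nonnegative choices in the other
    sets. The suprema are then real, and each is approached within [η / n]. *)
Lemma sum_ereal_sup_le (R : realType) (n : nat) (A : 'I_n -> set R) (e : R) :
  (forall i, A i !=set0) -> 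
  (forall i, A i `<=` [set y | 0 <= y]) ->
  (forall x : 'I_n -> R, (forall i, A i (x i)) -> \sum_(i < n) x i <= e) ->
  (\sum_(i < n) ereal_sup [set x%:E | x in A i] <= e%:E)%E.
Proof.
move=> A0 Age0 Ae.
have [x0 x0A] := choice A0.
have subA i : forall y, A i y -> y <= e.
  move=> y Aiy; apply: le_trans (Ae (fun j => if j == i then y else x0 j) _).
    rewrite (bigD1 i)//= eqxx lerDl sumr_ge0// => j /negbTE ->.
    exact: Age0 (x0A j).
  by move=> j; case: ifPn => [/eqP ->|].
have supE i : ereal_sup [set x%:E | x in A i] = (sup (A i))%:E.
  by rewrite ereal_sup_EFin//; exists e => y /subA.
under eq_bigr do rewrite supE.
rewrite sumEFin lee_fin; apply/ler_addgt0Pr => η η0.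
case: n => [|n] in A A0 Age0 Ae x0 x0A subA supE *.
  have := Ae x0 x0A; rewrite !big_ord0 => e0.
  by rewrite addr_ge0// ltW.
have hs i : has_sup (A i) by split => //; exists e => y /subA.
have ηn : 0 < η / n.+1%:R by rewrite divr_gt0.
have /choice[x xA] : forall i, exists y, A i y /\ sup (A i) - η / n.+1%:R < y.
  by move=> i; have [y Aiy yP] := sup_adherent ηn (hs i); exists y.
rewrite (@le_trans _ _ (\sum_(i < n.+1) (x i + η / n.+1%:R)))//.
  by apply: ler_sum => i _; rewrite -lerBlDr ltW//; have [] := xA i.
rewrite big_split/= sumr_const card_ord -[X in _ + X]mulr_natr divfK ?pnatr_eq0//.
by rewrite lerD2r Ae// => i; have [] := xA i.
Qed.

(** Partitions of the intervals are refinements of the family, so each choice of variations sums to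
    less than [e]; passing to suprema turns the strict bound into a large one. *)
Lemma ac_modulus_total_variation (R : realType) (f : R -> R) (a b e δ : R)
    (n : nat) (u v : 'I_n -> R) :
  ac_modulus f a b e δ ->
  (forall i, a <= u i /\ u i <= v i /\ v i <= b) ->
  (forall i j, i != j -> v i <= u j \/ v j <= u i) ->
  \sum_(i < n) (v i - u i) < δ ->
  (\sum_(i < n) total_variation (u i) (v i) f <= e%:E)%E.
Proof.
move=> fac uv disj sum_lt; apply: sum_ereal_sup_le => [i|i _ [s _ <-]|x xA].
- have [_ [uvi _]] := uv i; move: uvi; rewrite le_eqVlt => /predU1P[->|].
    by rewrite variationsxx; exists 0.
  exact: variations_neq0.
- exact: variation_ge0.
have /choice[s sP] : forall i, exists s,
    itv_partition (u i) (v i) s /\ variation (u i) (v i) f s = x i.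
  by move=> i; have [s sp <-] := xA i; exists s.
pose M := \max_(i < n) size (s i).
pose F i := nth (v i) (u i :: s i).
have sM i : (size (s i) <= M)%N by exact: (leq_bigmax i).
have FM i : F i M = v i.
  have [sp _] := sP i; move: (sM i); rewrite leq_eqVlt => /predU1P[<-|h].
    exact: itv_partition_nth_size.
  by rewrite /F nth_default.
have xE i : x i = \sum_(k < M) `|f (F i k.+1) - f (F i k)|.
  have [sp <-] := sP i; rewrite /variation -(big_mkord xpredT
    (fun k => `|f (F i k.+1) - f (F i k)|)) (big_cat_nat (leq0n _) (sM i))//=.
  rewrite [X in _ = _ + X](_ : _ = 0) ?addr0//.
  rewrite big_nat_cond big1// => k /andP[/andP[sk kM] _].
  have vk : F i k.+1 = v i by rewrite /F nth_default.
  have -> : F i k = v i.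
    move: sk; rewrite leq_eqVlt => /predU1P[<-|h]; last by rewrite /F nth_default.
    exact: itv_partition_nth_size.
  by rewrite vk subrr normr0.
under eq_bigr do rewrite xE.
apply/ltW/(ac_modulus_grid fac) => [i|i|i|i j ij|].
- by apply: itv_partition_nth_homo; have [] := sP i.
- by have [] := uv i.
- by rewrite FM; have [_ []] := uv i.
- by rewrite !FM; exact: disj.
- by under eq_bigr do rewrite FM.
Qed.

(** The modulus for [e = 1] bounds the variation by 1 on intervals shorter than [δ]; additivity of
    the variation and [interval_induction] do the rest. *)
Lemma abs_continuous_bounded_variation (R : realType) (f : R -> R) (a b : R) :
  a < b -> abs_continuous f a b -> total_variation a b f \is a fin_num.
Proof.
move=> ab fac; have [δ δ0 fδ] := fac 1 ltr01.
have tv_small s t : a <= s -> s < t -> t <= b -> t - s < δ ->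
    (total_variation s t f <= 1%:E)%E.
  move=> as_ st tb ts.
  have := @ac_modulus_total_variation _ f a b 1 δ 1 (fun=> s) (fun=> t) fδ.
  rewrite !big_ord1; apply => //; first by move=> _; split=> //; split => //; exact: ltW.
  by move=> i j; rewrite !ord1 eqxx.
rewrite ge0_fin_numE; last exact/total_variation_ge0/ltW.
apply: (@interval_induction _ (fun s t => total_variation s t f < +oo)%E _ _ ab).
- move=> s t u as_ st tu ub Pst Ptu.
  by rewrite (total_variationD _ (ltW st) (ltW tu)) lte_add_pinfty.
- move=> c ac cb; exists δ => // s t as_ sc ct tb st ts.
  by rewrite (le_lt_trans (tv_small s t _ _ _ _))// ltry.
Qed.

(** * Stieltjes measures of absolutely continuous functions *)

Section stieltjes.
Context {R : realType}.
Notation leb := (@lebesgue_measure R).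

Lemma stieltjes_itv_oc (G : cumulative R R) (s t : R) : s <= t ->
  lebesgue_stieltjes_measure G `]s, t]%classic = (G t - G s)%:E.
Proof.
move=> st; rewrite /lebesgue_stieltjes_measure /measure_extension/=.
by rewrite measurable_mu_extE/= ?wlength_itv_bnd//; exact: is_ocitv.
Qed.

Lemma stieltjes_set1 (G : cumulative R R) (s : R) : continuous G ->
  lebesgue_stieltjes_measure G [set s] = 0%E.
Proof.
move=> cG; apply/eqP; rewrite eq_le measure_ge0 andbT.
apply/lee_addgt0Pr => e e0; rewrite add0e.
have /cvgrPdist_lt /(_ e e0) [δ /= δ0 Gδ] := cG s.
have sd : s - δ / 2 <= s by rewrite gerBl divr_ge0// ltW.
rewrite (@le_trans _ _ (lebesgue_stieltjes_measure G `]s - δ / 2, s]%classic))//.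
  apply: le_measure; rewrite ?inE//=.
  by move=> _ /= ->; rewrite in_itv/= lexx andbT ltrBlDr ltrDl divr_gt0.
rewrite stieltjes_itv_oc// lee_fin (le_trans (ler_norm _))// ltW// Gδ//=.
rewrite opprB addrC subrK gtr0_norm ?divr_gt0//; lra.
Qed.

(** A null set has an open neighbourhood of Lebesgue measure below [δ]. Its components are disjoint
    intervals, so the modulus bounds the Stieltjes measure of any finite number of them by [e], and
    countable additivity passes to the limit. The point [b] is treated apart: it carries no mass
    because [G] is continuous. *)
Lemma stieltjes_dominated (G : cumulative R R) (a b : R) (A : set R) :
  a < b -> continuous G -> abs_continuous G a b -> measurable A ->
  leb A = 0%E -> lebesgue_stieltjes_measure G (A `&` `]a, b]%classic) = 0%E.
Proof.
move=> ab cG acG mA A0; pose μ : {measure set (measurableTypeR R) -> \bar R} :=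
  lebesgue_stieltjes_measure G.
rewrite -/(μ _).
pose B := A `&` `]a, b[%classic.
have mB : measurable B by exact: measurableI.
suff μB : μ B = 0%E.
  apply/eqP; rewrite eq_le measure_ge0 andbT.
  rewrite (@le_trans _ _ (μ (B `|` [set b])))//.
    apply: le_measure; rewrite ?inE//=; first exact: measurableI.
      exact: measurableU.
    move=> x [Ax] /=; rewrite in_itv/= => /andP[ax]; rewrite le_eqVlt.
    by move=> /predU1P[->|xb]; [right|left; split => //=; rewrite in_itv/= ax].
  apply: (le_trans (measureU2 _ _ _)) => //.
  by rewrite [X in (X + _)%E]μB [X in (_ + X)%E]stieltjes_set1// adde0.
have B0 : leb B = 0%E.
  apply/eqP; rewrite eq_le measure_ge0 andbT -A0.
  by apply: le_measure; rewrite ?inE//; exact: subIsetl.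
apply/eqP; rewrite eq_le measure_ge0 andbT.
apply/lee_addgt0Pr => e e0; rewrite add0e.
have [δ δ0 Gδ] := acG e e0.
have [|U [oU BU UB]] := @lebesgue_regularity_outer R B δ mB _ δ0.
  by rewrite [X in (X < _)%E]B0 ltry.
have mU : measurable U by exact: open_measurable.
pose W := U `&` `]a, b[%classic.
have oW : open W by apply: openI => //; exact: interval_open.
have BW : B `<=` W by move=> x Bx; split; [exact: BU|case: Bx].
have Wδ : (leb W < δ%:E)%E.
  rewrite (le_lt_trans _ UB)// (@le_trans _ _ (leb U))//.
    by apply: le_measure; rewrite ?inE//; [exact: open_measurable|exact: subIsetl].
  rewrite -(setDUK BU) (le_trans (measureU2 _ _ _))//; last first.
    by rewrite [X in (X + _)%E]B0 add0e setDUK.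
  exact: measurableD.
pose I := open_disjoint_itv oW.
have WE : W = \bigcup_k I k by exact: open_disjoint_itv_bigcup.
have oI k : open (I k) by exact: open_disjoint_itv_open.
have mI k : measurable (I k) by exact: open_measurable.
have tI : trivIset setT I by exact: open_disjoint_itv_trivIset.
have Iab k : I k `<=` `]a, b[%classic.
  by move=> x Ikx; have [] : W x by rewrite WE; exists k.
(* empty components are encoded by the degenerate interval ]a, a[ *)
have /choice[uv uvP] : forall k, exists uv : R * R,
   [/\ a <= uv.1, uv.1 <= uv.2, uv.2 <= b, I k = `]uv.1, uv.2[%classic &
       uv.1 = uv.2 -> uv.2 = a].
  move=> k; have [/eqP I0|/set0P I0] := boolP (I k == set0).
    exists (a, a); rewrite /= I0; split => //; first exact: ltW.
    by rewrite set_itv_ge// bnd_simp ltxx.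
  have lbI : has_lbound (I k).
    by exists a => x /Iab/=; rewrite in_itv/= => /andP[/ltW].
  have ubI : has_ubound (I k).
    by exists b => x /Iab/=; rewrite in_itv/= => /andP[_ /ltW].
  have iI : is_interval (I k) by exact: open_disjoint_itv_is_interval.
  have IE : I k = `]inf (I k), sup (I k)[%classic.
    have := interval_bounded_interior iI lbI ubI.
    rewrite ((interior_id _).1 (oI k)) => {1}->.
    by apply/seteqP; split => x /=; rewrite in_itv.
  have [x Ix] := I0.
  have /andP[ux xv] : inf (I k) < x < sup (I k) by move: Ix; rewrite {1}IE/= in_itv.
  exists (inf (I k), sup (I k)); split => //=.
  - by apply: lb_le_inf => // y /Iab/=; rewrite in_itv/= => /andP[/ltW].
  - exact/ltW/(lt_trans ux).
  - by apply: ge_sup => // y /Iab/=; rewrite in_itv/= => /andP[_ /ltW].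
  - by move=> uv; move: (lt_trans ux xv); rewrite uv ltxx.
rewrite (@le_trans _ _ (μ W))//.
  by apply: le_measure; rewrite ?inE//; exact: open_measurable.
rewrite WE measure_semi_bigcup//; last by rewrite -WE; exact: open_measurable.
apply: lime_le; first exact: is_cvg_nneseries.
apply: nearW => n; rewrite big_mkord.
have lebI k : leb (I k) = ((uv k).2 - (uv k).1)%:E.
  have [_ uvk _ -> _] := uvP k.
  rewrite lebesgue_measure_itv/= lte_fin; case: ltP => // vu.
  by rewrite (@le_anti _ _ (uv k).1 (uv k).2) ?subrr// uvk.
have μI k : (μ (I k) <= ((G (uv k).2) - (G (uv k).1))%:E)%E.
  have [_ uvk _ -> _] := uvP k.
  rewrite -stieltjes_itv_oc//; apply: le_measure; rewrite ?inE//.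
  by apply: subset_itvl; rewrite bnd_simp.
rewrite (@le_trans _ _ (\sum_(i < n) ((G (uv i).2) - (G (uv i).1))%:E)%E)//.
  by apply: lee_sum => i _; exact: μI.
rewrite sumEFin lee_fin ltW//.
apply: le_lt_trans (Gδ n (fun i => (uv i).1) (fun i => (uv i).2) _ _ _).
- by apply: ler_sum => i _; exact: ler_norm.
- by move=> i; have [] := uvP i.
(* A degenerate interval sits at [a], before every other one. Two proper components that overlapped
   would share the midpoint of the overlap. *)
- move=> i j ij; have [ai uvi _ IiE ui] := uvP i; have [aj uvj _ IjE uj] := uvP j.
  move: uvi; rewrite le_eqVlt => /predU1P[/ui ->|uvi]; first by left.
  move: uvj; rewrite le_eqVlt => /predU1P[/uj ->|uvj]; first by right.
  have [h|h] := leP (uv i).2 (uv j).1; first by left.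
  have [h'|h'] := leP (uv j).2 (uv i).1; first by right.
  pose l := Num.max (uv i).1 (uv j).1; pose r := Num.min (uv i).2 (uv j).2.
  have lr : l < r by rewrite gt_max !lt_min uvi uvj h h'.
  have il : (uv i).1 <= l by rewrite le_max lexx.
  have jl : (uv j).1 <= l by rewrite le_max lexx orbT.
  have ri : r <= (uv i).2 by rewrite ge_min lexx.
  have rj : r <= (uv j).2 by rewrite ge_min lexx orbT.
  have /trivIsetP/(_ (val i) (val j) Logic.I Logic.I ij) := tI.
  move=> /seteqP[/(_ ((l + r) / 2)) + _] => -[]; split.
    by rewrite IiE/= in_itv/=; apply/andP; split; lra.
  by rewrite IjE/= in_itv/=; apply/andP; split; lra.
- rewrite -lte_fin -sumEFin (le_lt_trans _ Wδ)//.
  under eq_bigr do rewrite -lebI.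
  have tIn : trivIset setT (fun i : 'I_n => I i).
    by move=> i j _ _ /(tI i j Logic.I Logic.I) /val_inj.
  rewrite -(measure_bigsetU_ord lebesgue_measure xpredT (fun i : 'I_n => mI i) tIn).
  apply: le_measure; rewrite ?inE//.
  - by apply: bigsetU_measurable => i _; exact: mI.
  - exact: open_measurable.
  - by rewrite WE -bigcup_mkord => x [k _ Ikx]; exists k.
Qed.

End stieltjes.

Lemma abs_continuous_dist (R : realType) (V : normedModType R) (f : R -> V) (a b e : R) :
  abs_continuous f a b -> 0 < e ->
  exists2 δ, 0 < δ & forall s t, a <= s -> s <= b -> a <= t -> t <= b ->
    `|s - t| < δ -> `|f s - f t| < e.
Proof.
move=> fac e0; have [δ δ0 fδ] := fac e e0; exists δ => //.
suff main s t : a <= s -> s <= t -> t <= b -> t - s < δ -> `|f t - f s| < e.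
  move=> s t as_ sb at_ tb st; have [h|h] := leP t s.
    by apply: main => //; rewrite ger0_norm ?subr_ge0 in st.
  rewrite distrC; apply: main => //; first exact: ltW.
  by rewrite distrC gtr0_norm ?subr_gt0 in st.
move=> as_ st tb ts; have := fδ 1%N (fun=> s) (fun=> t).
rewrite !big_ord1; apply => // i j; by rewrite !ord1 eqxx.
Qed.

Lemma abs_continuousB (R : realType) (V : normedModType R) (f g : R -> V) (a b : R) :
  abs_continuous f a b -> abs_continuous g a b -> abs_continuous (f \- g) a b.
Proof.
move=> fac gac e e0; have e2 : 0 < e / 2 by rewrite divr_gt0.
have [δ1 δ10 fδ] := fac _ e2; have [δ2 δ20 gδ] := gac _ e2.
exists (Num.min δ1 δ2) => [|n u v uv disj]; first by rewrite lt_min δ10.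
rewrite lt_min => /andP[uv1 uv2]; rewrite [e]splitr.
apply: le_lt_trans (ltrD (fδ n u v uv disj uv1) (gδ n u v uv disj uv2)).
rewrite -big_split/=; apply: ler_sum => i _.
have -> : f (v i) - g (v i) - (f (u i) - g (u i)) =
          (f (v i) - f (u i)) - (g (v i) - g (u i)).
  by rewrite !opprD !opprK addrACA.
exact: ler_normB.
Qed.

(** * Integral representation of absolutely continuous functions *)

Section density.
Context {R : realType}.
Notation leb := (@lebesgue_measure R).

(** For [a <= b], precomposition with this 1-Lipschitz retraction onto the interval extends a
    function on [[a, b]] continuously to the whole line, without new values; a curve in [Omega] thus
    stays there. *)
Definition clamp (a b t : R) : R := Num.max a (Num.min b t).

Lemma clamp_in (a b t : R) : a <= b -> a <= clamp a b t <= b.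
Proof. by move=> ab; rewrite /clamp le_max lexx ge_max ab ge_min lexx. Qed.

Lemma clamp_id (a b t : R) : a <= t <= b -> clamp a b t = t.
Proof. by move=> /andP[at_ tb]; rewrite /clamp (min_idPr tb) (max_idPr at_). Qed.

Lemma clamp_homo (a b : R) : {homo clamp a b : s t / s <= t}.
Proof. by move=> s t st; rewrite /clamp le_max2 // le_min2. Qed.

Lemma clamp_contract (a b s t : R) : `|clamp a b s - clamp a b t| <= `|s - t|.
Proof.
rewrite /clamp; have lp (x y : R) : x <= y ->
    Num.max a (Num.min b y) - Num.max a (Num.min b x) <= y - x.
  by move=> xy; case: (leP b x); case: (leP b y); case: (leP a b);
    case: (leP a x); case: (leP a y) => *; lra.
have [st|ts] := leP s t.
  rewrite distrC [leRHS]distrC !ger0_norm ?subr_ge0//; first exact: lp.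
  exact: clamp_homo.
have {}ts := ltW ts; rewrite !ger0_norm ?subr_ge0//; first exact: lp.
exact: clamp_homo.
Qed.

Lemma abs_continuous_clamp (V : normedModType R) (f : R -> V) (a b : R) :
  a <= b -> abs_continuous f a b -> continuous (f \o clamp a b).
Proof.
move=> ab fac t; apply/cvgrPdist_lt => e e0.
have [δ δ0 fδ] := abs_continuous_dist fac e0.
exists δ => //= s /= ts; have /andP[? ?] := clamp_in s ab.
have /andP[? ?] := clamp_in t ab.
by apply: fδ => //; rewrite (le_lt_trans (clamp_contract _ _ _ _)).
Qed.

Lemma monotone_density (F : R -> R) (a b : R) : a < b ->
  {in `[a, b] &, {homo F : s t / s <= t}} -> abs_continuous F a b ->
  exists2 g : R -> R, leb.-integrable setT (EFin \o g) &
    forall t, a <= t <= b -> \int[leb]_(u in `]a, t]) g u = F t - F a.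
Proof.
move=> ab ndF acF.
pose G := F \o clamp a b.
have cG : continuous G by exact: abs_continuous_clamp (ltW ab) acF.
have ndG : nondecreasing G.
  move=> s t st; apply: ndF; last exact: clamp_homo.
    by rewrite in_itv/= clamp_in// ltW.
  by rewrite in_itv/= clamp_in// ltW.
have GE t : a <= t <= b -> G t = F t by move=> atb; rewrite /G/= clamp_id.
have acG : abs_continuous G a b.
  move=> e e0; have [δ δ0 Fδ] := acF e e0; exists δ => // n u v uv disj uvδ.
  rewrite (eq_bigr (fun i => `|F (v i) - F (u i)|)) ?Fδ// => i _.
  have [au [ui vb]] := uv i.
  by rewrite !GE//; apply/andP; split => //; [exact: le_trans vb|exact: le_trans ui].
pose cumG := isCumulative.Build R _ R G ndG (right_continuousW cG).
pose H : cumulative R R := HB.pack G cumG.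
pose μ : {measure set (measurableTypeR R) -> \bar R} :=
  lebesgue_stieltjes_measure H.
have mab : measurable (`]a, b]%classic : set (measurableTypeR R)) by exact: measurable_itv.
have μab : (μ `]a, b]%classic < +oo)%E.
  by rewrite [ltLHS](stieltjes_itv_oc H (ltW ab)) ltry.
(* The restriction to []a, b]] has finite mass, and it is the measure whose domination
   [stieltjes_dominated] provides. *)
pose ν : {finite_measure set (measurableTypeR R) -> \bar R} := mfrestr mab μab.
have νleb : ν `<< leb.
  apply/null_content_dominatesP => A mA A0.
  exact: (@stieltjes_dominated _ H).
have [g [g0 gfin intg νE]] := @radon_nikodym_sigma_finite _ _ _ leb ν νleb.
have gE : EFin \o (fine \o g) = g by apply/funext => x /=; rewrite fineK.
exists (fine \o g); first by rewrite gE.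
move=> t /andP[at_ tb]; rewrite /Rintegral.
have -> : (\int[leb]_(u in `]a, t]) ((fine \o g) u)%:E)%E = (F t - F a)%:E.
  under eq_integral do rewrite /= fineK//.
  rewrite -νE; last exact: measurable_itv.
  rewrite /ν/= /mfrestr/= /mrestr (_ : _ `&` _ = `]a, t]%classic).
    rewrite [LHS](stieltjes_itv_oc H at_) /= !GE ?lexx ?(ltW ab)//.
    by rewrite at_ tb.
  apply/seteqP; split => x /=; first by move=> [].
  rewrite !in_itv/= => /andP[ax xt]; split; rewrite ax ?xt//=.
  exact: le_trans tb.
by [].
Qed.

(** Jordan decomposition: [f] is the difference of [V] and [V - f], where [V] is its variation
    function. Both are nondecreasing and absolutely continuous, so [monotone_density] applies to
    each. *)
Lemma abs_continuous_density (f : R -> R) (a b : R) : a < b ->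
  abs_continuous f a b ->
  exists2 g : R -> R, leb.-integrable setT (EFin \o g) &
    forall t, a <= t <= b -> \int[leb]_(u in `]a, t]) g u = f t - f a.
Proof.
move=> ab acf.
have TVfin := abs_continuous_bounded_variation ab acf.
pose V t := fine (total_variation a t f).
have VE s t : a <= s -> s <= t -> t <= b ->
    total_variation s t f = (V t - V s)%:E.
  move=> as_ st tb; have at_ := le_trans as_ st.
  have h : total_variation a t f \is a fin_num.
    move: TVfin; rewrite (total_variationD _ at_ tb).
    rewrite !ge0_fin_numE ?adde_ge0 ?total_variation_ge0//.
    by apply: le_lt_trans; rewrite leeDl// total_variation_ge0.
  have := h; rewrite (total_variationD _ as_ st) fin_numD => /andP[h1 h2].
  rewrite /V (total_variationD _ as_ st) fineD// addrC addKr fineK//.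
have Vle s t : a <= s -> s <= t -> t <= b -> `|f t - f s| <= V t - V s.
  by move=> as_ st tb; rewrite -lee_fin -VE// total_variation_ge.
have acV : abs_continuous V a b.
  (* Half of [e], because the bound on total variations is not strict. *)
  move=> e e0; have e2 : 0 < e / 2 by rewrite divr_gt0.
  have [δ δ0 fδ] := acf _ e2; exists δ => // n u v uv disj uvδ.
  rewrite (@le_lt_trans _ _ (e / 2))//; last lra.
  have := ac_modulus_total_variation fδ uv disj uvδ.
  rewrite (eq_bigr (fun i => `|V (v i) - V (u i)|%:E)); first by rewrite sumEFin lee_fin.
  move=> i _; have [ai [uvi ib]] := uv i; rewrite VE// ger0_norm//.
  by rewrite (le_trans _ (Vle _ _ _ _ _)).
have [g1 ig1 g1E] : exists2 g : R -> R, leb.-integrable setT (EFin \o g) &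
    forall t, a <= t <= b -> \int[leb]_(u in `]a, t]) g u = V t - V a.
  apply: monotone_density => // s t; rewrite !in_itv/= => /andP[as_ _] /andP[_ tb] st.
  by rewrite -subr_ge0 (le_trans _ (Vle _ _ _ _ _)).
have [g2 ig2 g2E] : exists2 g : R -> R, leb.-integrable setT (EFin \o g) &
    forall t, a <= t <= b -> \int[leb]_(u in `]a, t]) g u = (V \- f) t - (V \- f) a.
  apply: monotone_density => //; last exact: abs_continuousB.
  move=> s t; rewrite !in_itv/= => /andP[as_ _] /andP[_ tb] st.
  have := Vle _ _ as_ st tb; have := ler_norm (f t - f s); lra.
exists (g1 \- g2); first exact: (integrableB measurableT ig1 ig2).
move=> t atb; rewrite RintegralB//=.
- by rewrite g1E// g2E//=; lra.
- exact: integrableS ig1.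
- exact: integrableS ig2.
Qed.

End density.

(** * Comparison of integrals off a null set *)

Section null_sets.
Context {R : realType}.
Notation leb := (@lebesgue_measure R).
Local Open Scope ereal_scope.
Import HBNNSimple.

(* Stated for arbitrary f and g since derive1 of a curve is only known to agree
   off a null set with a measurable function. It holds because the integral of a
   nonnegative function is a supremum over simple functions. *)
Lemma ge0_le_integral_null (D E Z : set R) (f g : R -> \bar R) :
  measurable Z -> leb Z = 0 ->
  (forall t, D t -> 0 <= f t) -> (forall t, E t -> 0 <= g t) ->
  (forall t, D t -> ~ Z t -> E t /\ f t <= g t) ->
  \int[leb]_(t in D) f t <= \int[leb]_(t in E) g t.
Proof.
move=> mZ Z0 f0 g0 fg; rewrite !ge0_integralE//.
apply: ge_ereal_sup => _ [h /= hf <-].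
have mCZ : measurable (~` Z) by exact: measurableC.
apply: le_ereal_sup_tmp; exists (sintegral leb (proj_nnsfun h mCZ)).
  exists (proj_nnsfun h mCZ) => // t /=; rewrite mindicE.
  have gE0 : 0 <= (g \_ E) t.
    by rewrite patchE; case: ifPn => // /set_mem; exact: g0.
  have [Zt|nZt] := pselect (Z t); first by rewrite memNset ?mulr0// => /(_ Zt).
  rewrite mem_set// mulr1 (le_trans (hf t))// !patchE.
  case: ifPn => [/set_mem Dt|_]; last by rewrite -patchE.
  by have [Et fgt] := fg t Dt nZt; rewrite mem_set.
rewrite -!integralT_nnsfun le_eqVlt; apply/orP; left; apply/eqP.
apply: ae_eq_integral => //.
- exact/measurable_EFinP.
- exact/measurable_EFinP.
exists Z; split => // t /= ht; apply: contrapT => nZt; apply: ht => _.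
by rewrite mindicE mem_set// mulr1.
Qed.

Lemma ge0_eq_integral_null (D Z : set R) (f g : R -> \bar R) :
  measurable Z -> leb Z = 0 ->
  (forall t, D t -> 0 <= f t) -> (forall t, D t -> 0 <= g t) ->
  (forall t, D t -> ~ Z t -> f t = g t) ->
  \int[leb]_(t in D) f t = \int[leb]_(t in D) g t.
Proof.
move=> mZ Z0 f0 g0 fg; apply/eqP; rewrite eq_le; apply/andP; split.
  by apply: (ge0_le_integral_null mZ Z0) => // t Dt nZt; rewrite fg.
by apply: (ge0_le_integral_null mZ Z0) => // t Dt nZt; rewrite fg.
Qed.

End null_sets.

(** * Derivatives of curves of configurations *)

Section matrix_density.
Context {R : realType} {N d : nat}.
Notation leb := (@lebesgue_measure R).

Lemma mx_entry_norm_le (A : 'M[R]_(N, d)) i j : `|A i j| <= `|A|.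
Proof.
rewrite [leRHS]/Num.Def.normr/= mx_normrE.
by apply: (le_bigmax _ (fun k : 'I_N * 'I_d => `|A k.1 k.2|) (i, j)).
Qed.

Lemma abs_continuous_entry (γ : R -> 'M[R]_(N, d)) (a b : R) i j :
  abs_continuous γ a b -> abs_continuous (fun t => γ t i j) a b.
Proof.
move=> ac e e0; have [δ δ0 γδ] := ac e e0; exists δ => // n u v uv disj uvδ.
apply: le_lt_trans (γδ n u v uv disj uvδ); apply: ler_sum => k _.
by have := mx_entry_norm_le (γ (v k) - γ (u k)) i j; rewrite !mxE.
Qed.

(** Lebesgue differentiation applies to the indefinite integral [F] of [g]. The function [f] agrees
    with [F + f a] only on [[a, b]], hence in a neighbourhood only of interior points. *)
Lemma abs_continuous_derivable_ae (f g : R -> R) (a b : R) : a < b ->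
  leb.-integrable setT (EFin \o g) ->
  (forall t, a <= t <= b -> \int[leb]_(u in `]a, t]) g u = f t - f a) ->
  {ae leb, forall t, a < t < b -> derivable f t 1 /\ derive1 f t = g t}.
Proof.
move=> ab ig gf.
have locg : locally_integrable [set: R] g.
  by have := integrable_locally measurableT ig; rewrite patch_setT.
have igs y : leb.-integrable `]a, y] (EFin \o g) by exact: integrableS ig.
have := FTC1 igs locg.
apply: filterS; first exact: (ae_filter_ringOfSetsType leb).
move=> t ht /andP[at_ tb].
have [|dF F't] := ht; first by exact: at_.
set F := (fun x => \int[leb]_(u in _) g u) in dF F't.
have nearE : \near t, (F + cst (f a)) t = f t.
  near=> x; rewrite fctE /F gf ?subrK//; apply/andP; split; apply: ltW; near: x.
    exact: lt_nbhsr.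
  exact: lt_nbhsl.
clearbody F.
have dc : derivable (cst (f a) : R -> R) t 1 := derivable_cst _ _ _.
split; first exact: near_eq_derivable nearE (derivableD dF dc).
rewrite derive1E -(near_eq_derive _ nearE) (deriveD dF dc) derive_cst addr0.
by rewrite -derive1E F't.
Unshelve. all: by end_near. Qed.

Lemma abs_continuous_mx_density (γ : R -> 'M[R]_(N, d)) (a b : R) : a < b ->
  abs_continuous γ a b ->
  exists (v : R -> 'M[R]_(N, d)) (Z : set R),
    [/\ measurable Z, leb Z = 0%E,
        forall i j, leb.-integrable setT (fun t => (v t i j)%:E),
        forall t, a <= t <= b -> ~ Z t -> derive1 γ t = v t &
        forall i j t, a <= t <= b ->
          \int[leb]_(u in `]a, t]) v u i j = γ t i j - γ a i j].
Proof.
move=> ab acγ.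
have /choice[g gP] : forall ij : 'I_N * 'I_d, exists g : R -> R,
    leb.-integrable setT (EFin \o g) /\
    forall t, a <= t <= b ->
      \int[leb]_(u in `]a, t]) g u = γ t ij.1 ij.2 - γ a ij.1 ij.2.
  move=> [i j]; have [g ig gE] := abs_continuous_density ab
    (abs_continuous_entry i j acγ).
  by exists g.
pose v t : 'M[R]_(N, d) := \matrix_(i, j) g (i, j) t.
have : {ae leb, forall t, forall ij : 'I_N * 'I_d, a < t < b ->
   derivable (fun t => γ t ij.1 ij.2) t 1 /\
   derive1 (fun t => γ t ij.1 ij.2) t = g ij t}.
  have aeF := ae_filter_ringOfSetsType leb.
  apply: filter_forall => ij; have [ig gE] := gP ij.
  exact: abs_continuous_derivable_ae ab ig gE.
move=> [Z0 [mZ0 Z00 Z0P]].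
(* The endpoints join the exceptional set: [derive1] there depends on values of the curve outside
   [[a, b]]. *)
exists v, (Z0 `|` [set a] `|` [set b]); split.
- by do 2?apply: measurableU.
- rewrite !null_set_setU//; try exact: lebesgue_measure_set1.
  exact: measurableU.
- move=> i j; have [ig _] := gP (i, j); rewrite (_ : (fun _ => _) = EFin \o g (i, j))//.
  by apply/funext => t; rewrite /v mxE.
- move=> t /andP[at_ tb] /not_orP[/not_orP[nZ ta] tb'].
  have {}at_ : a < t by rewrite lt_neqAle at_ andbT eq_sym; apply/eqP.
  have {}tb : t < b by rewrite lt_neqAle tb andbT; apply/eqP.
  have H : forall ij : 'I_N * 'I_d, derivable (fun t => γ t ij.1 ij.2) t 1 /\
      derive1 (fun t => γ t ij.1 ij.2) t = g ij t.
    apply: contrapT => nH; apply: nZ; apply: Z0P => /= h; apply: nH => ij.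
    by apply: h; rewrite at_.
  rewrite derive1E derive_mx.
    by apply/matrixP => i j; rewrite !mxE -derive1E; have [_ ->] := H (i, j).
  by apply/derivable_mxP => i j; have [] := H (i, j).
- move=> i j t atb; have [_ <-//] := gP (i, j).
  by apply: eq_Rintegral => u _; rewrite mxE.
Qed.

End matrix_density.

(** * Geometry of the mass metric and of the potential *)

Section mass_geometry.
Context {R : realType} {N d : nat}.
Notation leb := (@lebesgue_measure R).
Variable m : 'I_N -> R.
Hypothesis m_gt0 : forall i, 0 < m i.
Implicit Types v w : 'M[R]_(N, d).

Let m_ge0 i : 0 <= m i. Proof. exact: ltW. Qed.

Lemma mass_dotE v w :
  mass_dot m v w = \sum_(p : 'I_N * 'I_d) m p.1 * v p.1 p.2 * w p.1 p.2.
Proof.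
rewrite /mass_dot -(pair_big xpredT xpredT
  (fun i k => m i * v i k * w i k))/=; apply: eq_bigr => i _.
by rewrite /dotp mulr_sumr; apply: eq_bigr => k _; rewrite !mxE mulrA.
Qed.

Lemma mass_dot_ge0 v : 0 <= mass_dot m v v.
Proof.
rewrite mass_dotE sumr_ge0// => p _; rewrite -mulrA mulr_ge0 ?m_ge0//.
by rewrite -expr2 sqr_ge0.
Qed.

Lemma mass_norm_ge0 v : 0 <= mass_norm m v.
Proof. exact: sqrtr_ge0. Qed.

Lemma mass_norm_sqr v : mass_norm m v ^+ 2 = mass_dot m v v.
Proof. by rewrite sqr_sqrtr// mass_dot_ge0. Qed.

Lemma mass_dot_comb (c e : R) v w :
  mass_dot m (c *: v + e *: w) (c *: v + e *: w) =
  c ^+ 2 * mass_dot m v v + 2 * c * e * mass_dot m v w + e ^+ 2 * mass_dot m w w.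
Proof.
rewrite !mass_dotE !mulr_sumr -!big_split/=; apply: eq_bigr => p _.
by rewrite !mxE; ring.
Qed.

Lemma mass_dotC v w : mass_dot m v w = mass_dot m w v.
Proof. by rewrite !mass_dotE; apply: eq_bigr => p _; ring. Qed.

Lemma mass_normZ (c : R) v : mass_norm m (c *: v) = `|c| * mass_norm m v.
Proof.
rewrite /mass_norm -sqrtr_sqr -sqrtrM ?sqr_ge0//; congr Num.sqrt.
by rewrite !mass_dotE mulr_sumr; apply: eq_bigr => p _; rewrite !mxE; ring.
Qed.

Lemma mass_normN v : mass_norm m (- v) = mass_norm m v.
Proof. by rewrite -scaleN1r mass_normZ normrN1 mul1r. Qed.

Lemma mass_dot_null v w : mass_norm m v = 0 -> mass_dot m v w = 0.
Proof.
move=> v0; apply/eqP; apply/negP => /negP vw0.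
(* If [v] has norm 0 and the product with [w] does not vanish, the coefficient is chosen so that
   this combination has square norm -1. *)
have := mass_dot_ge0
  ((- (mass_dot m w w + 1) / (2 * mass_dot m v w)) *: v + 1 *: w).
rewrite mass_dot_comb -(mass_norm_sqr v) v0 expr0n/= mulr0 add0r !mulr1.
have -> : 2 * (- (mass_dot m w w + 1) / (2 * mass_dot m v w)) * mass_dot m v w
    = - (mass_dot m w w + 1) by field.
by lra.
Qed.

Lemma mass_dot_CS v w : mass_dot m v w <= mass_norm m v * mass_norm m w.
Proof.
have [v0|v0] := eqVneq (mass_norm m v) 0.
  by rewrite mass_dot_null// v0 mul0r.
have [w0|w0] := eqVneq (mass_norm m w) 0.
  by rewrite mass_dotC mass_dot_null// w0 mulr0.
have a0 : 0 < mass_norm m v by rewrite lt_neqAle eq_sym v0 mass_norm_ge0.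
have b0 : 0 < mass_norm m w by rewrite lt_neqAle eq_sym w0 mass_norm_ge0.
(* With [a], [b] the norms and [c] the product, this square norm expands to
   [2 * a * b * (a * b - c)]. *)
have := mass_dot_ge0 (mass_norm m w *: v + (- mass_norm m v) *: w).
rewrite mass_dot_comb -!mass_norm_sqr.
set a := mass_norm m v in a0 *; set b := mass_norm m w in b0 *.
set c := mass_dot m v w => h.
have ab0 : 0 < a * b by rewrite mulr_gt0.
have : 0 <= (a * b) * (a * b - c) by nra.
by rewrite pmulr_rge0// subr_ge0.
Qed.

Lemma mass_norm_entry v i k : Num.sqrt (m i) * `|v i k| <= mass_norm m v.
Proof.
rewrite -sqrtr_sqr -sqrtrM ?m_ge0// ler_wsqrtr// mass_dotE (bigD1 (i, k))//=.
rewrite expr2 mulrA lerDl sumr_ge0// => p _.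
by rewrite -mulrA mulr_ge0 ?m_ge0// -expr2 sqr_ge0.
Qed.

(** This comparison of the l2 and l1 norms makes the speed integrable as soon as the entries of the
    velocity are. *)
Lemma mass_norm_le_sum v :
  mass_norm m v <= \sum_(p : 'I_N * 'I_d) Num.sqrt (m p.1) * `|v p.1 p.2|.
Proof.
set s := \sum_ _ _; have s0 : 0 <= s by apply: sumr_ge0 => p _; rewrite mulr_ge0// sqrtr_ge0.
rewrite -[leRHS]ger0_norm// -sqrtr_sqr ler_wsqrtr// mass_dotE /s expr2 mulr_suml.
apply: ler_sum => p _.
rewrite (le_trans (y := (Num.sqrt (m p.1) * `|v p.1 p.2|) ^+ 2))//.
  by rewrite exprMn sqr_sqrtr ?m_ge0// real_normK ?num_real// expr2 mulrA.
rewrite expr2 ler_wpM2l ?mulr_ge0 ?sqrtr_ge0//.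
rewrite (bigD1 p)//= lerDl sumr_ge0// => q _; by rewrite mulr_ge0// sqrtr_ge0.
Qed.

Lemma measurable_mass_norm (D : set R) (v : R -> 'M[R]_(N, d)) :
  (forall i k, measurable_fun D (fun t => v t i k)) ->
  measurable_fun D (fun t => mass_norm m (v t)).
Proof.
move=> mv; apply: (@measurableT_comp _ _ _ _ _ _ (@Num.sqrt R)).
  by apply: continuous_measurable_fun; exact: sqrt_continuous.
under eq_fun do rewrite mass_dotE.
apply: measurable_sum => p; apply: measurable_funM => //.
by apply: measurable_funM.
Qed.

Lemma integrable_mass_norm (v : R -> 'M[R]_(N, d)) :
  (forall i k, leb.-integrable setT (fun t => (v t i k)%:E)) ->
  leb.-integrable setT (fun t => (mass_norm m (v t))%:E).
Proof.
move=> iv; have mv i k : measurable_fun setT (fun t => v t i k).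
  by have /measurable_int/measurable_EFinP := iv i k.
apply: (@le_integrable _ _ _ lebesgue_measure _ measurableT _ (fun t =>
  \sum_(p <- index_enum ('I_N * 'I_d)%type)
    ((Num.sqrt (m p.1))%:E * `|(v t p.1 p.2)%:E|))%E).
- by apply/measurable_EFinP; exact: measurable_mass_norm.
- move=> t _; under eq_bigr do rewrite abse_EFin -EFinM.
  rewrite sumEFin !abse_EFin lee_fin ger0_norm ?mass_norm_ge0//.
  by rewrite (le_trans (mass_norm_le_sum _))// ler_norm.
- apply: integrable_sum => // p _; apply: integrableZl => //.
  exact: integrable_abse.
Qed.

(** Pairing with the chord [q] reduces the claim to scalar integrals: the square norm of [q] is the
    integral of its product with [v], which Cauchy-Schwarz bounds by the norm of [q] times the
    integral of the speed. *)
Lemma mass_dist_le_integral (γ v : R -> 'M[R]_(N, d)) (s t : R) :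
  (forall i k, leb.-integrable setT (fun u => (v u i k)%:E)) ->
  (forall i k, \int[leb]_(u in `]s, t]) v u i k = γ t i k - γ s i k) ->
  mass_norm m (γ t - γ s) <= \int[leb]_(u in `]s, t]) mass_norm m (v u).
Proof.
move=> iv vE; set q := γ t - γ s.
have iP (p : 'I_N * 'I_d) :
    leb.-integrable `]s, t] (fun u => (m p.1 * q p.1 p.2 * v u p.1 p.2)%:E).
  have := iv p.1 p.2; move=> /(@integrableS _ _ _ leb _ `]s, t]%classic).
  by move=> /(_ measurableT)/(_ (measurable_itv _))/(_ (@subsetT _ _))/integrableZl; exact.
have qE : mass_norm m q ^+ 2 = \int[leb]_(u in `]s, t]) mass_dot m q (v u).
  rewrite mass_norm_sqr /Rintegral.
  under eq_integral do rewrite mass_dotE -sumEFin.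
  rewrite integral_sum// -sum_fine; last first.
    by move=> p _; apply: integrable_fin_num.
  rewrite mass_dotE; apply: eq_bigr => p _; rewrite -/(Rintegral _ _ _).
  rewrite RintegralZl//; last by apply: integrableS (iv _ _).
  by rewrite vE /q !mxE.
have imn : leb.-integrable `]s, t] (fun u => (mass_norm m (v u))%:E).
  by apply: integrableS (integrable_mass_norm iv).
have [q0|q0] := eqVneq (mass_norm m q) 0.
  by rewrite q0 Rintegral_ge0// => u _; exact: mass_norm_ge0.
have {}q0 : 0 < mass_norm m q by rewrite lt_neqAle eq_sym q0 mass_norm_ge0.
rewrite -(ler_pM2l q0) -expr2 qE -RintegralZl//.
apply: le_Rintegral => //.
- rewrite (_ : EFin \o _ = (fun u => \sum_(p <- index_enum ('I_N * 'I_d)%type)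
      (m p.1 * q p.1 p.2 * v u p.1 p.2)%:E)%E); first exact: integrable_sum.
  by apply/funext => u /=; rewrite mass_dotE sumEFin.
- exact: (integrableZl _ (mass_norm m q) imn).
- by move=> u _; exact: mass_dot_CS.
Qed.

End mass_geometry.

Lemma cvg_sum (R : realType) (T I : Type) (F : set_system T) {FF : Filter F}
    (r : seq I)
    (P : pred I) (f : I -> T -> R) (l : I -> R) :
  (forall i, P i -> f i x @[x --> F] --> l i) ->
  \sum_(i <- r | P i) f i x @[x --> F] --> \sum_(i <- r | P i) l i.
Proof. by move=> fl; apply: cvg_big => //; exact: add_continuous. Qed.

Lemma lebesgue_itvcc (R : realType) (s t : R) : s <= t ->
  lebesgue_measure `[s, t]%classic = (t - s)%:E.
Proof.
move=> st; rewrite lebesgue_measure_itv/= lte_fin; case: ltP => // ts.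
by rewrite (@le_anti _ _ s t) ?subrr// st.
Qed.

(** * The Newtonian potential, and action and length through a measurable speed *)

Section newton.
Context {R : realType} {N d : nat}.
Notation leb := (@lebesgue_measure R).
Variables (m : 'I_N -> R) (h : R).
Hypothesis m_gt0 : forall i, 0 < m i.
Hypothesis h_ge0 : 0 <= h.
Implicit Types x y z : 'M[R]_(N, d).

Lemma dotp_ge0 (e : 'rV[R]_d) : 0 <= dotp e e.
Proof. by rewrite sumr_ge0// => k _; rewrite -expr2 sqr_ge0. Qed.

Lemma enorm_eq0 (e : 'rV[R]_d) : (enorm e == 0) = (e == 0).
Proof.
rewrite sqrtr_eq0 le_eqVlt ltNge dotp_ge0 orbF psumr_eq0; last first.
  by move=> k _; rewrite -expr2 sqr_ge0.
apply/allP/eqP => [e0|-> k _]; last by rewrite mxE mulr0 eqxx implybT.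
apply/rowP => k; rewrite mxE; apply/eqP.
by have := e0 k (mem_index_enum _); rewrite implyTb mulf_eq0 orbb.
Qed.

Lemma dist_ij_ge0 x i j : 0 <= dist_ij x i j.
Proof. exact: sqrtr_ge0. Qed.

Lemma dist_ij_gt0 x i j : (0 < dist_ij x i j) = (row i x != row j x).
Proof.
by rewrite lt_neqAle dist_ij_ge0 andbT eq_sym enorm_eq0 subr_eq0.
Qed.

Lemma OmegaP x : Omega x <-> forall i j, i != j -> 0 < dist_ij x i j.
Proof. by split=> Ox i j ij; have := Ox i j ij; rewrite dist_ij_gt0. Qed.

Lemma continuous_dist_ij i j : continuous (fun x => dist_ij x i j).
Proof.
move=> x; pose q y := \sum_(k < d) (y i k - y j k) * (y i k - y j k) : R.
have -> : (fun y => dist_ij y i j) = Num.sqrt \o q.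
  apply/funext => y; rewrite /= /dist_ij /enorm /dotp; congr Num.sqrt.
  by apply: eq_bigr => k _; rewrite !mxE.
apply: continuous_comp; last exact: sqrt_continuous.
apply: (cvg_sum (F := nbhs x)) => k _; apply: cvgM; apply: cvgB; exact: coord_continuous.
Qed.

Lemma newton_sum_ge0 x : 0 <= newton_sum m x.
Proof.
rewrite sumr_ge0// => i _; rewrite sumr_ge0// => j _.
by rewrite mulr_ge0 ?invr_ge0 ?dist_ij_ge0// mulr_ge0// ltW.
Qed.

Lemma newton_sum_ge_pair x (i j : 'I_N) : (i < j)%N ->
  m i * m j / dist_ij x i j <= newton_sum m x.
Proof.
move=> ij; have t0 k l : 0 <= m k * m l / dist_ij x k l.
  by rewrite mulr_ge0 ?invr_ge0 ?dist_ij_ge0// mulr_ge0// ltW.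
rewrite /newton_sum (bigD1 i)//= (bigD1 j)//= -addrA lerDl addr_ge0// ?sumr_ge0//.
by move=> k _; rewrite sumr_ge0.
Qed.

Lemma newton_sum_gt0 x : (2 <= N)%N -> Omega x -> 0 < newton_sum m x.
Proof.
move=> N2 /OmegaP Ox; pose i := Ordinal (ltnW N2); pose j := Ordinal N2.
by rewrite (lt_le_trans _ (@newton_sum_ge_pair x i j _))// divr_gt0 ?mulr_gt0// Ox.
Qed.

Lemma near_Omega x : Omega x -> \forall z \near x, Omega z.
Proof.
move=> /OmegaP Ox.
pose P (ij : 'I_N * 'I_N) z := ij.1 != ij.2 -> 0 < dist_ij z ij.1 ij.2.
have xP : \forall z \near x, forall ij, P ij z.
  apply: (@filter_forall _ _ P (nbhs x)) => -[i j]; rewrite /P/=.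
  have [ij|ij] := boolP (i != j); last by apply: nearW.
  have : \forall z \near x, 0 < dist_ij z i j.
    by have /cvgr_gt := @continuous_dist_ij i j x; apply; exact: Ox.
  by apply: filterS.
by apply: filterS xP => z zP; apply/OmegaP => i j ij; exact: (zP (i, j)).
Qed.

Lemma newton_sum_continuous x : Omega x ->
  {for x, continuous (newton_sum m : 'M[R]_(N, d) -> R)}.
Proof.
move=> /OmegaP Ox; apply: (cvg_sum (F := nbhs x)) => i _.
apply: (cvg_sum (F := nbhs x)) => j ij.
apply: cvgM; first exact: cvg_cst.
apply: cvgV; last exact: continuous_dist_ij.
by rewrite gt_eqF// Ox//; apply: contraTneq ij => ->; rewrite ltnn.
Qed.

Lemma potentialE x : Omega x -> potential m x = (newton_sum m x)%:E.
Proof. by move=> Ox; rewrite /potential asboolT. Qed.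

(* sqrt (2 (h + U)): the factor by which j_h multiplies mass lengths *)
Definition jm_factor x : R := Num.sqrt (2 * (h + newton_sum m x)).

Lemma jm_factor_ge0 x : 0 <= jm_factor x.
Proof. exact: sqrtr_ge0. Qed.

Lemma jm_factor_sqr x : jm_factor x ^+ 2 = 2 * (h + newton_sum m x).
Proof. by rewrite sqr_sqrtr// mulr_ge0// addr_ge0// newton_sum_ge0. Qed.

Lemma jm_factor_continuous x : Omega x -> {for x, continuous jm_factor}.
Proof.
move=> Ox; apply: (@continuous_comp _ _ _ (fun z => 2 * (h + newton_sum m z)) Num.sqrt).
  2: exact: sqrt_continuous.
by apply: (cvgM (F := nbhs x)); [exact: cvg_cst|apply: (cvgD (F := nbhs x));
  [exact: cvg_cst|exact: newton_sum_continuous]].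
Qed.

Lemma sqrt_jm_metric x v :
  Num.sqrt (jm_metric m h x v v) = jm_factor x * mass_norm m v.
Proof.
by rewrite /jm_metric sqrtrM// mulr_ge0// addr_ge0// newton_sum_ge0.
Qed.

Lemma ge0_integral_itv_split (f : R -> \bar R) (s t r : R) :
  s <= t -> t <= r -> measurable_fun `[s, r] f ->
  (forall u, `[s, r]%classic u -> 0 <= f u)%E ->
  (\int[leb]_(u in `[s, r]) f u =
   \int[leb]_(u in `[s, t]) f u + \int[leb]_(u in `[t, r]) f u)%E.
Proof.
move=> st tr mf f0.
have E : `[s, r]%classic = `[s, t]%classic `|` `]t, r]%classic.
  by rewrite -itv_bndbnd_setU// bnd_simp.
rewrite [in LHS]E ge0_integral_setU//= -?E//; last first.
  apply/disj_set2P/seteqP; split => // u []/=; rewrite !in_itv/= => /andP[_ ut] /andP[tu _].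
  by move: (lt_le_trans tu ut); rewrite ltxx.
  by move=> u su; apply: f0; rewrite E.
congr (_ + _)%E; rewrite integral_itv_obnd_cbnd//.
by apply: measurable_funS mf => //; rewrite E; exact: subsetUr.
Qed.

(* sp is the speed of γ, corrected on a null set so as to be measurable *)
Lemma curve_representation (γ : R -> 'M[R]_(N, d)) (a b : R) :
  a < b -> abs_continuous γ a b -> (forall t, a <= t <= b -> Omega (γ t)) ->
  exists sp : R -> R,
  [/\ forall t, 0 <= sp t,
      leb.-integrable setT (EFin \o sp),
      forall s t, a <= s -> s <= t -> t <= b -> action m h γ s t =
        (\int[leb]_(u in `[s, t])
          (sp u ^+ 2 / 2 + newton_sum m (γ (clamp a b u)) + h)%:E)%E,
      forall s t, a <= s -> s <= t -> t <= b -> jm_length m h γ `[s, t] =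
        (\int[leb]_(u in `[s, t]) (jm_factor (γ (clamp a b u)) * sp u)%:E)%E &
      forall s t, a <= s -> s <= t -> t <= b ->
        mass_norm m (γ t - γ s) <= \int[leb]_(u in `[s, t]) sp u].
Proof.
move=> ab acγ Oγ.
have [v [Z [mZ Z0 iv dγ vE]]] := abs_continuous_mx_density ab acγ.
pose sp u := mass_norm m (v u).
have isp : leb.-integrable setT (EFin \o sp) by exact: integrable_mass_norm.
have sp0 u : 0 <= sp u by exact: mass_norm_ge0.
have cl s t u : a <= s -> t <= b -> s <= u <= t -> clamp a b u = u.
  move=> as_ tb /andP[su ut]; apply: clamp_id.
  by rewrite (le_trans as_ su) (le_trans ut tb).
have msp : measurable_fun setT sp by have /measurable_int/measurable_EFinP := isp.
have cU : continuous (fun u => newton_sum m (γ (clamp a b u))).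
  move=> u; apply: (@continuous_comp _ _ _ (γ \o clamp a b)).
    exact: (abs_continuous_clamp (ltW ab) acγ).
  by apply: newton_sum_continuous; apply: Oγ; apply: clamp_in; exact: ltW.
have mU := continuous_measurable_fun cU.
exists sp; split => //.
- move=> s t as_ st tb; rewrite /action.
  have -> : (\int[leb]_(u in `[s, t]) lagrangian m (γ u) (derive1 γ u) =
             \int[leb]_(u in `[s, t])
               (sp u ^+ 2 / 2 + newton_sum m (γ (clamp a b u)))%:E)%E.
    apply: (ge0_eq_integral_null mZ Z0).
    + move=> u _; rewrite /lagrangian adde_ge0//.
        by rewrite lee_fin divr_ge0// sqr_ge0.
      by rewrite /potential; case: ifP => _; rewrite ?leey// lee_fin newton_sum_ge0.
    + by move=> u _; rewrite lee_fin addr_ge0 ?newton_sum_ge0// divr_ge0// sqr_ge0.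
    + move=> u; rewrite /= in_itv/= => stu nZu.
      have abu : a <= u <= b.
        by move: stu => /andP[su ut]; rewrite (le_trans as_ su) (le_trans ut tb).
      rewrite /lagrangian dγ// potentialE; last exact: Oγ.
      by rewrite (cl s t).
  have hst : ((h * (t - s))%:E = \int[leb]_(u in `[s, t]) h%:E)%E.
    by rewrite integral_cst// [X in (_ * X)%E](lebesgue_itvcc st).
  rewrite hst -ge0_integralD//=.
  + by move=> u _; rewrite lee_fin addr_ge0 ?newton_sum_ge0// divr_ge0// sqr_ge0.
  + apply/measurable_EFinP; apply: measurable_funTS; apply: measurable_funD => //.
    by apply: measurable_funM => //; exact: measurable_funX.
- move=> s t as_ st tb; rewrite /jm_length.
  apply: (ge0_eq_integral_null mZ Z0).
  + by move=> u _; rewrite lee_fin sqrtr_ge0.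
  + by move=> u _; rewrite lee_fin mulr_ge0 ?jm_factor_ge0.
  + move=> u; rewrite /= in_itv/= => stu nZu.
    have abu : a <= u <= b.
      by move: stu => /andP[su ut]; rewrite (le_trans as_ su) (le_trans ut tb).
    by rewrite sqrt_jm_metric dγ// (cl s t).
- move=> s t as_ st tb.
  rewrite -Rintegral_itv_obnd_cbnd; last by apply: integrableS isp.
  apply: mass_dist_le_integral => // i k.
  have as' : a <= s <= b by rewrite as_ (le_trans st).
  have at' : a <= t <= b by rewrite tb (le_trans as_).
  (* The primitives of [v] are known from [a] only; the integral from [s] to [t] is a difference of
     two of them. *)
  have := Rintegral_itvB (f := fun u => v u i k) (a := BRight a) (b := BRight t) (x := s).
  rewrite vE// vE// => <-//; first by rewrite opprB addrA subrK.
  by apply: integrableS (iv i k).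
Qed.

End newton.

(** * Polygonal approximation of curves *)

Section abs_continuous_piecewise.
Context {R : realType}.

Lemma lipschitz_abs_continuous (V : normedModType R) (f : R -> V) (a b C : R) :
  (forall s t, a <= s -> s <= t -> t <= b -> `|f t - f s| <= C * (t - s)) ->
  abs_continuous f a b.
Proof.
move=> fC e e0; pose K := `|C| + 1.
have K0 : 0 < K by rewrite ltr_wpDl.
exists (e / K) => [|n u v uv disj]; first by rewrite divr_gt0.
rewrite ltr_pdivlMr// mulrC mulr_sumr; apply: le_lt_trans.
apply: ler_sum => i _; have [ai [uvi ib]] := uv i.
rewrite (le_trans (fC _ _ ai uvi ib))// ler_wpM2r ?subr_ge0//.
by rewrite (le_trans (ler_norm _))// /K lerDl.
Qed.

(* f v + f b = f (min v b) + f (max v b) splits each increment at b *)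
Lemma abs_continuous_cat (V : normedModType R) (f : R -> V) (a b c : R) :
  a <= b -> b <= c -> abs_continuous f a b -> abs_continuous f b c ->
  abs_continuous f a c.
Proof.
move=> ab bc f1 f2 e e0; have e2 : 0 < e / 2 by rewrite divr_gt0.
have [δ1 δ10 fδ1] := f1 _ e2; have [δ2 δ20 fδ2] := f2 _ e2.
exists (Num.min δ1 δ2) => [|n u v uv disj]; first by rewrite lt_min δ10.
rewrite lt_min => /andP[uv1 uv2].
have fE x : f x = f (Num.min x b) + f (Num.max x b) - f b.
  by case: (leP x b) => _; rewrite ?addrK// addrC addKr.
have minP x y : x <= y -> Num.min x b <= Num.min y b by move=> xy; rewrite le_min2.
have maxP x y : x <= y -> Num.max x b <= Num.max y b by move=> xy; rewrite le_max2.
have h1 : \sum_(i < n) `|f (Num.min (v i) b) - f (Num.min (u i) b)| < e / 2.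
  apply: (fδ1 n (fun i => Num.min (u i) b) (fun i => Num.min (v i) b)).
  - move=> i; have [ai [uvi ib]] := uv i.
    by rewrite le_min ai ab minP// ge_min lexx orbT.
  - by move=> i j ij; have [/minP|/minP] := disj i j ij; [left|right].
  - apply: le_lt_trans uv1; apply: ler_sum => i _; have [ai [uvi ib]] := uv i.
    by case: (leP (v i) b) => ?; case: (leP (u i) b) => ?; lra.
have h2 : \sum_(i < n) `|f (Num.max (v i) b) - f (Num.max (u i) b)| < e / 2.
  apply: (fδ2 n (fun i => Num.max (u i) b) (fun i => Num.max (v i) b)).
  - move=> i; have [ai [uvi ib]] := uv i.
    by rewrite le_max lexx orbT maxP// ge_max ib bc.
  - by move=> i j ij; have [/maxP|/maxP] := disj i j ij; [left|right].
  - apply: le_lt_trans uv2; apply: ler_sum => i _; have [ai [uvi ib]] := uv i.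
    by case: (leP (v i) b) => ?; case: (leP (u i) b) => ?; lra.
rewrite [e]splitr; apply: le_lt_trans (ltrD h1 h2).
rewrite -big_split/=; apply: ler_sum => i _.
rewrite [in leLHS](fE (v i)) [in leLHS](fE (u i)).
have -> : forall x y z t w : V, x + y - w - (z + t - w) = (x - z) + (y - t).
  by move=> x y z t w; rewrite opprB addrA subrK opprD addrACA.
exact: ler_normD.
Qed.

Lemma abs_continuous_eq (V : normedModType R) (f g : R -> V) (a b : R) :
  (forall t, a <= t <= b -> f t = g t) -> abs_continuous f a b ->
  abs_continuous g a b.
Proof.
move=> fg fac e e0; have [δ δ0 fδ] := fac e e0; exists δ => // n u v uv disj uvδ.
rewrite (eq_bigr (fun i => `|f (v i) - f (u i)|)) ?fδ// => i _.
have [ai [uvi ib]] := uv i.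
by rewrite !fg// ?ai ?ib ?(le_trans ai)// (le_trans uvi).
Qed.

Lemma C1_lipschitz (f : R -> R) (a b : R) :
  (forall s, derivable f s 1) -> continuous (derive1 f) ->
  exists C, forall s t, a <= s -> s <= t -> t <= b -> `|f t - f s| <= C * (t - s).
Proof.
move=> df cf'; have [ba|ab] := ltP b a.
  exists 0 => s t as_ st tb.
  by have := le_lt_trans (le_trans as_ (le_trans st tb)) ba; rewrite ltxx.
have cn : {within `[a, b], continuous (fun t => `|derive1 f t|)}.
  apply: continuous_subspaceT => t.
  by apply: (continuous_comp (cf' t)); exact: norm_continuous.
have [c _ cmax] := EVT_max ab cn.
exists `|derive1 f c| => s t as_; rewrite le_eqVlt => /predU1P[->|st] tb.
  by rewrite !subrr normr0 mulr0.
have [x xst ->] : exists2 x, x \in `]s, t[%R & f t - f s = derive1 f x * (t - s).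
  apply: MVT => //.
    by move=> x _; rewrite derive1E; apply: DeriveDef => //; exact: df.
  apply: continuous_subspaceT => x; apply: differentiable_continuous.
  exact/derivable1_diffP.
have ts0 : 0 <= t - s by rewrite subr_ge0 ltW.
rewrite normrM [X in _ * X]ger0_norm// ler_wpM2r//.
apply: (cmax x); move: xst; rewrite !in_itv/= => /andP[sx xt].
by rewrite (le_trans as_ (ltW sx)) (le_trans (ltW xt) tb).
Qed.

Lemma C1_mx_abs_continuous (N d : nat) (f : R -> 'M[R]_(N, d)) (a b : R) :
  (forall s, derivable f s 1) -> continuous (derive1 f) -> abs_continuous f a b.
Proof.
move=> df cf'.
have dfij i j s : derivable (fun t => f t i j) s 1.
  by have /derivable_mxP := df s; apply.
have /choice[C CP] : forall ij : 'I_N * 'I_d, exists C, forall s t,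
    a <= s -> s <= t -> t <= b -> `|f t ij.1 ij.2 - f s ij.1 ij.2| <= C * (t - s).
  move=> [i j] /=; apply: C1_lipschitz => //.
  have -> : derive1 (fun t => f t i j) = fun t => derive1 f t i j.
    by apply/funext => t; rewrite !derive1E derive_mx// mxE.
  move=> t; apply: (@continuous_comp _ _ _ (derive1 f)
    (fun M : 'M[R]_(N, d) => M i j)); [exact: cf'|exact: coord_continuous].
apply: (@lipschitz_abs_continuous _ _ _ _ (\sum_ij `|C ij|)) => s t as_ st tb.
have ts0 : 0 <= t - s by rewrite subr_ge0.
rewrite [leLHS]/Num.Def.normr/= mx_normrE.
apply: bigmax_le => [|[i j] _]; first by rewrite mulr_ge0// sumr_ge0.
rewrite !mxE/= (le_trans (CP (i, j) _ _ as_ st tb))// ler_wpM2r//.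
by rewrite (le_trans (ler_norm _))// (bigD1 (i, j))//= lerDl sumr_ge0.
Qed.

Lemma piecewise_C1_abs_continuous (N d : nat) (f : R -> 'M[R]_(N, d)) (a b : R) :
  piecewise_C1 f a b -> abs_continuous f a b.
Proof.
move=> [n [t [<- <- tlt tC1]]].
suff : (forall k, (k <= n)%N -> t 0%N <= t k /\ abs_continuous f (t 0%N) (t k)).
  by move=> /(_ n (leqnn n))[].
elim=> [_|k ih kn].
  split=> //; apply: (@lipschitz_abs_continuous _ _ _ _ 0) => s r ts sr rt.
  by rewrite (@le_anti _ _ s r) ?subrr ?normr0 ?mul0r// sr (le_trans rt ts).
have [t0k fk] := ih (ltnW kn); have tk := tlt k kn; split.
  exact: le_trans (ltW tk).
apply: (abs_continuous_cat t0k (ltW tk) fk).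
have [g [dg cg' fg]] := tC1 k kn.
apply: (@abs_continuous_eq _ g) => [s ks|]; first by rewrite fg.
exact: C1_mx_abs_continuous.
Qed.

Lemma piecewise_C1_cat (V : normedModType R) (f g : R -> V) (a b c : R) :
  piecewise_C1 f a b -> piecewise_C1 g b c -> f b = g b ->
  piecewise_C1 (fun t => if t <= b then f t else g t) a c.
Proof.
move=> [n1 [t1 [t1a t1b t1lt t1C]]] [n2 [t2 [t2b t2c t2lt t2C]]] fgb.
(* At the junction index [n1] both subdivisions give [b]; likewise [fgb] makes the value at time [b]
   fit the first piece of [g]. *)
pose t i := if (i <= n1)%N then t1 i else t2 (i - n1)%N.
have t1le k : (k <= n1)%N -> t1 k <= b.
  move=> kn; rewrite -t1b; have -> : n1 = (k + (n1 - k))%N by rewrite subnKC.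
  have : (k + (n1 - k) <= n1)%N by rewrite subnKC.
  elim: (n1 - k)%N => [|l ih]; first by rewrite addn0.
  by rewrite addnS => kl; rewrite (le_trans (ih (ltnW kl)))// ltW// t1lt.
have t2le k : (k <= n2)%N -> b <= t2 k.
  elim: k => [|k ih kn]; first by rewrite t2b.
  by rewrite (le_trans (ih (ltnW kn)))// ltW// t2lt.
exists (n1 + n2)%N, t; split.
- by rewrite /t leq0n.
- rewrite /t; case: leqP => [|_]; last by rewrite addKn.
  by rewrite -{2}[n1]addn0 leq_add2l leqn0 => /eqP n20; rewrite n20 addn0 t1b -t2c n20 t2b.
- move=> i i12; rewrite /t; have [i1|i1] := ltnP i n1; first by rewrite ltnW// t1lt.
  rewrite subSn// ; have i2 : (i - n1 < n2)%N by rewrite ltn_subLR.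
  move: i1; rewrite leq_eqVlt => /predU1P[<-|i1]; last by rewrite leqNgt i1/= t2lt.
  by rewrite leqnn t1b subnn -t2b t2lt// (leq_ltn_trans _ i2).
- move=> i i12; rewrite /t; have [i1|i1] := ltnP i n1.
    rewrite ltnW//; have [g1 [dg1 cg1 fg1]] := t1C i i1; exists g1; split => // s si.
    have /andP[_ s2] := si.
    by rewrite (le_trans s2 (t1le _ i1)) fg1.
  have i2 : (i - n1 < n2)%N by rewrite ltn_subLR.
  rewrite subSn//; have [g2 [dg2 cg2 fg2]] := t2C _ i2; exists g2; split => // s.
  move: i1 fg2; rewrite leq_eqVlt => /predU1P[<-|i1] fg2.
    rewrite leqnn t1b => /andP[bs sr]; rewrite -fg2; last by rewrite {1}subnn t2b bs.
    by case: ifP => // sb; rewrite (@le_anti _ _ s b) ?fgb// bs sb.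
  rewrite leqNgt i1/= => si; rewrite -fg2//; case: ifP => // sb.
  have /andP[s1 _] := si.
  rewrite (@le_anti _ _ s b) ?fgb// sb (le_trans _ s1)// t2le//.
  exact: ltnW.
Qed.

End abs_continuous_piecewise.

(** * Paths of controlled action *)

Section reachable.
Context {R : realType} {N d : nat}.
Notation leb := (@lebesgue_measure R).
Variables (m : 'I_N -> R) (h : R).
Hypothesis m_gt0 : forall i, 0 < m i.
Hypothesis h_ge0 : 0 <= h.
Implicit Types p q z : 'M[R]_(N, d).

Lemma lagrangian_ge0 z v : (0 <= lagrangian m z v)%E.
Proof.
rewrite /lagrangian adde_ge0//; first by rewrite lee_fin divr_ge0// sqr_ge0.
by rewrite /potential; case: ifP => _; rewrite ?leey// lee_fin newton_sum_ge0.
Qed.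

(** The curves have equal germs, hence equal derivatives, at interior points only; the two endpoints
    form a null set. *)
Lemma action_eq (γ η : R -> 'M[R]_(N, d)) (a b : R) :
  (forall t, a <= t <= b -> γ t = η t) -> action m h γ a b = action m h η a b.
Proof.
move=> γη; have mZ : measurable [set a; b] by apply: measurableU.
have Z0 : leb [set a; b] = 0%E.
  by rewrite null_set_setU//; exact: lebesgue_measure_set1.
have γη' t : `[a, b]%classic t -> ~ [set a; b] t ->
    lagrangian m (γ t) (derive1 γ t) = lagrangian m (η t) (derive1 η t).
  rewrite /= in_itv/= => atb /not_orP[ta tb].
  have at_ : a < t by rewrite lt_neqAle eq_sym (andP atb).1 andbT; apply/eqP.
  have tb' : t < b by rewrite lt_neqAle (andP atb).2 andbT; apply/eqP.
  suff dE : derive1 γ t = derive1 η t by rewrite dE γη.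
  rewrite !derive1E; apply: near_eq_derive.
  near=> s; apply: γη; apply/andP; split; apply: ltW; near: s.
    exact: lt_nbhsr.
  exact: lt_nbhsl.
have L0 (ζ : R -> 'M[R]_(N, d)) t : `[a, b]%classic t ->
    (0 <= lagrangian m (ζ t) (derive1 ζ t))%E by move=> _; exact: lagrangian_ge0.
have E := ge0_eq_integral_null mZ Z0 (L0 γ) (L0 η) γη'.
exact: (f_equal (fun x => x + (h * (b - a))%:E)%E E).
Unshelve. all: by end_near. Qed.

(** Splitting the integral requires a measurable integrand, which the representation by [sp]
    supplies. *)
Lemma action_split (γ : R -> 'M[R]_(N, d)) (a t b : R) :
  a < t -> t < b -> abs_continuous γ a b ->
  (forall s, a <= s <= b -> Omega (γ s)) ->
  action m h γ a b = (action m h γ a t + action m h γ t b)%E.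
Proof.
move=> at_ tb acγ Oγ; have ab := lt_trans at_ tb.
have [sp [sp0 isp aE _ _]] := curve_representation m_gt0 h_ge0 ab acγ Oγ.
have [at' tb' ab'] := And3 (ltW at_) (ltW tb) (ltW ab).
rewrite !aE//; apply: ge0_integral_itv_split => //.
- have msp : measurable_fun setT sp by have /measurable_int/measurable_EFinP := isp.
  apply/measurable_EFinP; apply: measurable_funTS; apply: measurable_funD => //.
  apply: measurable_funD; first by apply: measurable_funM => //; exact: measurable_funX.
  apply: continuous_measurable_fun => u.
  apply: (@continuous_comp _ _ _ (γ \o clamp a b)).
    exact: (abs_continuous_clamp ab' acγ).
  by apply: newton_sum_continuous; apply: Oγ; exact: clamp_in.
- move=> u _; rewrite lee_fin addr_ge0// addr_ge0 ?newton_sum_ge0//.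
  by rewrite divr_ge0// sqr_ge0.
Qed.

(** The starting time is arbitrary so that paths can be concatenated without translating them in
    time. A single witness bounds both [action_potential] and [jm_dist] by [A]. *)
Definition reachable p q (A : R) : Prop :=
  forall a, exists b (γ : R -> 'M[R]_(N, d)),
    [/\ a < b, γ a = p /\ γ b = q, piecewise_C1 γ a b,
        forall t, a <= t <= b -> Omega (γ t) &
        (action m h γ a b <= A%:E)%E].

Lemma reachable_trans p q z (A B : R) :
  reachable p q A -> reachable q z B -> reachable p z (A + B).
Proof.
move=> rA rB a; have [b [γ [ab [γa γb] γC γO γA]]] := rA a.
have [c [η [bc [ηb ηc] ηC ηO ηB]]] := rB b.
pose ζ t := if t <= b then γ t else η t.
have ζγ t : a <= t <= b -> ζ t = γ t by move=> /andP[_ tb]; rewrite /ζ tb.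
have ζη t : b <= t <= c -> ζ t = η t.
  move=> /andP[bt tc]; rewrite /ζ; case: ifP => // tb.
  by rewrite (@le_anti _ _ t b) ?tb// γb ηb.
have ζC : piecewise_C1 ζ a c by apply: piecewise_C1_cat => //; rewrite γb.
have ζO t : a <= t <= c -> Omega (ζ t).
  move=> /andP[at_ tc]; have [tb|bt] := leP t b; last first.
    by rewrite ζη ?(ltW bt)//; apply: ηO; rewrite (ltW bt).
  by rewrite ζγ ?at_//; apply: γO; rewrite at_.
exists c, ζ; split => //; first exact: lt_trans bc.
  by rewrite ζγ ?lexx ?ltW// ζη ?lexx ?ltW.
rewrite (action_split ab bc (piecewise_C1_abs_continuous ζC) ζO).
by rewrite (action_eq ζγ) (action_eq ζη) EFinD leeD.
Qed.

(* The segment is run in time A / κ^2, which balances kinetic and potential terms *)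
Lemma reachable_segment p q (κ A : R) : 0 < κ ->
  (forall s, 0 <= s <= 1 -> Omega (p + s *: (q - p)) /\
    jm_factor m h (p + s *: (q - p)) <= κ) ->
  κ * mass_norm m (q - p) < A -> reachable p q A.
Proof.
move=> κ0 segP pqA a.
(* The strict hypothesis matters when [p = q]: it still leaves a positive duration [τ]. *)
have A0 : 0 < A by rewrite (le_lt_trans _ pqA)// mulr_ge0 ?mass_norm_ge0// ltW.
pose τ := A / κ ^+ 2; have τ0 : 0 < τ by rewrite divr_gt0// exprn_gt0.
pose γ t := p + ((t - a) / τ) *: (q - p).
have dγij i j (t : R) :
    is_derive t 1 (fun u : R => γ u i j) (τ^-1 * (q - p) i j).
  pose c := τ^-1 * (q - p) i j.
  have -> : (fun u : R => γ u i j) = (c \*: @id R) + cst (p i j - c * a).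
    apply/funext => u; rewrite /γ !mxE /= !fctE /c !mxE.
    rewrite [X in _ = X + _](_ : _ = τ^-1 * (q i j - p i j) * u)//.
    by field; rewrite gt_eqF.
  have D1 : is_derive t 1 (c \*: @id R) (c * 1) by exact: is_deriveZ.
  have := is_deriveD D1 (is_derive_cst (p i j - c * a) t 1).
  by rewrite addr0 mulr1.
have dγ t : derivable γ t 1 by apply/derivable_mxP => i j; exact: ex_derive.
have dγE : derive1 γ = cst (τ^-1 *: (q - p)).
  apply/funext => t; rewrite derive1E derive_mx//; apply/matrixP => i j.
  by rewrite !mxE; have := dγij i j t => /(@derive_val _ _ _ _ _ _ _) ->; rewrite !mxE.
have Oγ t : a <= t <= a + τ -> Omega (γ t) /\ jm_factor m h (γ t) <= κ.
  move=> /andP[at_ tb]; apply: segP.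
  by rewrite divr_ge0 ?subr_ge0 ?(ltW τ0)//= ler_pdivrMr// mul1r lerBlDl.
exists (a + τ), γ; split.
- by rewrite ltrDl.
- split; rewrite /γ; first by rewrite subrr mul0r scale0r addr0.
  by rewrite (addrC a) addrK divff ?gt_eqF// scale1r addrC subrK.
- exists 1%N, (fun k => if k is 0%N then a else a + τ); split => //.
    by move=> [|//] _; rewrite ltrDl.
  move=> [|//] _; exists γ; split; [exact: dγ| |by []].
  by rewrite dγE => u; exact: cvg_cst.
- by move=> t /Oγ[].
set n := mass_norm m (q - p) in pqA *.
(* The speed is constantly [n / τ], and [jm_factor <= κ] means that [U <= κ ^+ 2 / 2 - h] on the
   segment. *)
pose c := (τ^-1 * n) ^+ 2 / 2 + (κ ^+ 2 / 2 - h).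
have Lc t : a <= t <= a + τ -> (lagrangian m (γ t) (derive1 γ t) <= c%:E)%E.
  move=> /Oγ[Ot jt]; rewrite /lagrangian potentialE// -EFinD lee_fin dγE.
  rewrite mass_normZ ger0_norm ?invr_ge0 ?(ltW τ0)// lerD2l.
  rewrite lerBrDl ler_pdivlMr// mulrC -(jm_factor_sqr m_gt0 h_ge0).
  by rewrite lerXn2r// nnegrE ?jm_factor_ge0// ltW.
have c0 : 0 <= c.
  have /Lc : a <= a <= a + τ by rewrite lexx lerDl ltW.
  by rewrite -lee_fin; apply: le_trans; exact: lagrangian_ge0.
rewrite (@le_trans _ _ (c * τ + h * τ)%:E)//.
  rewrite EFinD /action [X in h * X](_ : _ = τ) ?leeD2r//; last by rewrite (addrC a) addrK.
  have -> : ((c * τ)%:E = \int[leb]_(t in `[a, (a + τ)%R]) c%:E)%E.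
    rewrite integral_cst// [X in (_ * X)%E]lebesgue_itvcc ?lerDl ?(ltW τ0)//.
    by rewrite (addrC a) addrK.
  apply: (ge0_le_integral_null measurable0) => //.
  - by move=> t _; exact: lagrangian_ge0.
  - by move=> t ht _; split => //; apply: Lc; move: ht; rewrite /= in_itv.
(* The kinetic term contributes [(κ * n) ^+ 2 / (2 * A)] and the rest [A / 2]; the former is at most
   [A / 2] because [κ * n < A]. *)
rewrite lee_fin /c -mulrDl.
have n0 : 0 <= n := mass_norm_ge0 _ _.
have -> : ((τ^-1 * n) ^+ 2 / 2 + (κ ^+ 2 / 2 - h) + h) * τ =
    (κ * n) ^+ 2 / (2 * A) + A / 2.
  by rewrite /τ; field; rewrite !gt_eqF.
rewrite -lerBrDr ler_pdivrMr ?mulr_gt0//.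
have : (κ * n) ^+ 2 <= A ^+ 2.
  by rewrite lerXn2r ?nnegrE ?mulr_ge0 ?(ltW κ0) ?(ltW A0) ?(ltW pqA).
nra.
Qed.

End reachable.

(** * From the length of a curve to the action of polygons *)

Section chain.
Context {R : realType} {N d : nat}.
Notation leb := (@lebesgue_measure R).
Variables (m : 'I_N -> R) (h : R).
Hypothesis m_gt0 : forall i, 0 < m i.
Hypothesis h_ge0 : 0 <= h.
Implicit Types p q z : 'M[R]_(N, d).

Lemma integrable_continuousM (w f : R -> R) (a b : R) : a <= b ->
  continuous w -> leb.-integrable setT (EFin \o f) ->
  leb.-integrable `[a, b] (fun t => (w t * f t)%:E).
Proof.
move=> ab cw intf.
have cn : {within `[a, b], continuous (fun t => `|w t|)}.
  apply: continuous_subspaceT => t.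
  by apply: (continuous_comp (cw t)); exact: norm_continuous.
have [c _ cmax] := EVT_max ab cn.
have mf : measurable_fun setT f by have /measurable_int/measurable_EFinP := intf.
apply: (@le_integrable _ _ _ lebesgue_measure _ _ _
  (fun t => (`|w c|%:E * (f t)%:E)%E)) => //.
- apply/measurable_EFinP; apply: measurable_funTS; apply: measurable_funM => //.
  exact: continuous_measurable_fun.
- move=> t; rewrite /= => tab; rewrite lee_fin !normrM normr_id.
  by rewrite ler_wpM2r//; exact: (cmax t).
- by apply: integrableZl => //; apply: integrableS intf.
Qed.

Lemma jm_factor_near (x : 'M[R]_(N, d)) (η : R) : Omega x -> 0 < η ->
  exists2 r, 0 < r & forall z, `|x - z| < r ->
    Omega z /\ `|jm_factor m h x - jm_factor m h z| < η.
Proof.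
move=> Ox η0.
have /cvgrPdist_lt/(_ _ η0) near1 := jm_factor_continuous (m := m) (h := h) Ox.
have near2 := near_Omega Ox.
have /nbhs_normP[r /= r0 rP] : \forall z \near x, Omega z /\
    `|jm_factor m h x - jm_factor m h z| < η.
  by near=> z; split; near: z.
by exists r.
Unshelve. all: by end_near. Qed.

Lemma segment_ball (x p q : 'M[R]_(N, d)) (r s : R) :
  `|x - p| < r -> `|x - q| < r -> 0 <= s <= 1 -> `|x - (p + s *: (q - p))| < r.
Proof.
move=> xp xq /andP[s0 s1].
have -> : x - (p + s *: (q - p)) = (1 - s) *: (x - p) + s *: (x - q).
  by apply/matrixP => i j; rewrite !mxE; ring.
have s1' : 0 <= 1 - s by rewrite subr_ge0.
rewrite (le_lt_trans (ler_normD _ _))// !normrZ !ger0_norm//.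
have [->|sn1] := eqVneq s 1; first by rewrite subrr mul0r add0r mul1r.
have s1'' : 0 < 1 - s by rewrite subr_gt0 lt_neqAle sn1.
have : (1 - s) * `|x - p| < (1 - s) * r by rewrite ltr_pM2l.
have : s * `|x - q| <= s * r by rewrite ler_wpM2l// ltW.
lra.
Qed.

(** Chords between nearby times are glued by [interval_induction], against the additive budget
    [F s t + η * (t - s)]. Both directions come together, as the chord estimate is symmetric in its
    endpoints; no curve has to be reversed. *)
Lemma curve_reachable (γ : R -> 'M[R]_(N, d)) (a b : R) :
  a < b -> abs_continuous γ a b -> (forall t, a <= t <= b -> Omega (γ t)) ->
  exists2 l : R, jm_length m h γ `[a, b] = l%:E &
  forall e, 0 < e -> reachable m h (γ a) (γ b) (l + e) /\
                     reachable m h (γ b) (γ a) (l + e).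
Proof.
move=> ab acγ Oγ.
have [sp [sp0 isp _ lE dist_le]] := curve_representation m_gt0 h_ge0 ab acγ Oγ.
have ab' := ltW ab.
pose w u := jm_factor m h (γ (clamp a b u)).
have cγ := abs_continuous_clamp ab' acγ.
have Ocl u : Omega (γ (clamp a b u)) by apply: Oγ; exact: clamp_in.
have cw : continuous w.
  move=> u; apply: (@continuous_comp _ _ _ (γ \o clamp a b)); first exact: cγ.
  by apply: jm_factor_continuous; exact: Ocl.
have iw := integrable_continuousM ab' cw isp.
pose l := \int[leb]_(u in `[a, b]) (w u * sp u).
have lenE : jm_length m h γ `[a, b] = l%:E.
  rewrite lE ?lexx// /l /Rintegral fineK//.
  exact: integrable_fin_num.
exists l => // e e0.
pose S := \int[leb]_(u in `[a, b]) sp u.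
have S0 : 0 <= S by apply: Rintegral_ge0 => u _; exact: sp0.
(* The total excess over [l] is [η * S], from the factor [w + η], plus [η * (b - a)]; this choice
   makes it equal to [e]. *)
pose η := e / (S + (b - a)).
have Sba : 0 < S + (b - a) by rewrite ltr_wpDl// subr_gt0.
have η0 : 0 < η by rewrite divr_gt0.
have cwη : continuous (fun u => w u + η).
  by move=> u; apply: cvgD; [exact: cw|exact: cvg_cst].
have iwη : leb.-integrable `]a, b] (fun u => ((w u + η) * sp u)%:E).
  apply: integrableS (integrable_continuousM ab' cwη isp) => //.
  by apply: subset_itvr; rewrite bnd_simp.
pose F s t := \int[leb]_(u in `]s, t]) ((w u + η) * sp u).
have iF s t : a <= s -> t <= b -> leb.-integrable `]s, t] (fun u => ((w u + η) * sp u)%:E).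
  move=> as_ tb; apply: integrableS iwη => //.
  by apply: subset_itv; rewrite bnd_simp.
have FD s t r : a <= s -> s <= t -> t <= r -> r <= b -> F s r = F s t + F t r.
  move=> as_ st tr rb; rewrite /F.
  have := Rintegral_itvB (f := fun u => (w u + η) * sp u)
    (a := BRight s) (b := BRight r) (x := t) (iF s r as_ rb).
  by rewrite !bnd_simp => /(_ st tr) <-; rewrite addrC subrK.
pose P s t := reachable m h (γ s) (γ t) (F s t + η * (t - s)) /\
              reachable m h (γ t) (γ s) (F s t + η * (t - s)).
have Pab : P a b.
  apply: (@interval_induction _ P a b ab).
  - move=> s t r as_ st tr rb [Pst Pts] [Ptr Prt].
    have E : F s r + η * (r - s) = F s t + η * (t - s) + (F t r + η * (r - t)).
      by rewrite (FD s t r)// ?ltW//; ring.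
    split; first by rewrite E; exact: reachable_trans Pst Ptr.
    by rewrite E addrC; exact: reachable_trans Prt Pts.
  - move=> c ac cb.
    have Oc : Omega (γ c) by apply: Oγ; rewrite ac.
    have η2 : 0 < η / 2 by rewrite divr_gt0.
    have [r r0 rP] := jm_factor_near Oc η2.
    have cc : clamp a b c = c by apply: clamp_id; rewrite ac.
    have /cvgrPdist_lt/(_ _ r0) [δ /= δ0 δP] := cγ c.
    have δP' u : a <= u <= b -> `|c - u| < δ -> `|γ c - γ u| < r.
      by move=> uab cu; have := δP u cu; rewrite /= cc clamp_id.
    exists δ => // s t as_ sc ct tb st tsδ.
    have sab : a <= s <= b by rewrite as_ (le_trans sc).
    have tab : a <= t <= b by rewrite tb (le_trans ac).
    have rs : `|γ c - γ s| < r by apply: δP' => //; rewrite ger0_norm ?subr_ge0//; lra.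
    have rt : `|γ c - γ t| < r.
      by apply: δP' => //; rewrite distrC ger0_norm ?subr_ge0//; lra.
    (* Within [r] of [γ c] the factor varies by less than [η / 2]: it is at most [κ] on the chord,
       while [κ] is at most [w + η] along the arc. *)
    pose κ := jm_factor m h (γ c) + η / 2.
    have κ0 : 0 < κ by rewrite ltr_wpDl// jm_factor_ge0.
    have seg p q : `|γ c - p| < r -> `|γ c - q| < r -> forall s, 0 <= s <= 1 ->
        Omega (p + s *: (q - p)) /\ jm_factor m h (p + s *: (q - p)) <= κ.
      move=> hp hq v v01; have [Oz zκ] := rP _ (segment_ball hp hq v01); split => //.
      by move: zκ; rewrite /κ ltr_norml => /andP[]; lra.
    have κF : κ * mass_norm m (γ t - γ s) <= F s t.
      have isp' : leb.-integrable `]s, t] (EFin \o sp) by apply: integrableS isp.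
      rewrite (@le_trans _ _ (κ * \int[leb]_(u in `]s, t]) sp u))//.
        by rewrite ler_pM2l// Rintegral_itv_obnd_cbnd// dist_le// ltW.
      rewrite -RintegralZl//; apply: le_Rintegral => //.
      - exact: (integrableZl _ κ isp').
      - exact: iF.
      - move=> u; rewrite /= in_itv/= => /andP[su ut].
        have uab : a <= u <= b by rewrite (le_trans as_ (ltW su)) (le_trans ut tb).
        rewrite ler_wpM2r// /κ /w clamp_id//.
        have cu : `|c - u| < δ by rewrite ltr_norml; apply/andP; split; lra.
        have wκ := (rP _ (δP' u uab cu)).2.
        by move: wκ; rewrite ltr_norml => /andP[]; lra.
    (* The term [η * (t - s)] provides the strict inequality that [reachable_segment] demands, even
       when the chord is trivial. *)
    have κF' : κ * mass_norm m (γ t - γ s) < F s t + η * (t - s).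
      by rewrite (le_lt_trans κF)// ltrDl mulr_gt0// subr_gt0.
    split; first exact: (reachable_segment m_gt0 h_ge0 κ0 (seg _ _ rs rt)).
    apply: (reachable_segment m_gt0 h_ge0 κ0 (seg _ _ rt rs)).
    by rewrite -opprB mass_normN.
have FE : F a b + η * (b - a) = l + e.
  have -> : F a b = l + η * S.
    rewrite /F Rintegral_itv_obnd_cbnd// /l /S.
    have isp' : leb.-integrable `[a, b] (EFin \o sp) by apply: integrableS isp.
    rewrite -RintegralZl// -RintegralD//; last exact: (integrableZl _ η isp').
    by apply: eq_Rintegral => u _; rewrite mulrDl.
  by rewrite -addrA -mulrDr /η divfK ?gt_eqF.
by move: Pab; rewrite /P FE.
Qed.

End chain.

(** * Free time minimizers *)

Section minimizer.
Context {R : realType} {N d : nat}.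
Notation leb := (@lebesgue_measure R).
Variables (m : 'I_N -> R) (h : R).
Hypothesis m_gt0 : forall i, 0 < m i.
Hypothesis h_ge0 : 0 <= h.
Implicit Types p q z : 'M[R]_(N, d).

Lemma jm_length_le_action (γ : R -> 'M[R]_(N, d)) (a b : R) : a < b ->
  abs_continuous γ a b -> (forall t, a <= t <= b -> Omega (γ t)) ->
  (jm_length m h γ `[a, b] <= action m h γ a b)%E.
Proof.
move=> ab acγ Oγ.
have [sp [sp0 _ aE lE _]] := curve_representation m_gt0 h_ge0 ab acγ Oγ.
have ab' := ltW ab; rewrite aE ?lexx// lE ?lexx//.
apply: (ge0_le_integral_null measurable0) => //.
- by move=> t _; rewrite lee_fin mulr_ge0// jm_factor_ge0.
- move=> t _; rewrite lee_fin addr_ge0// addr_ge0 ?newton_sum_ge0//.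
  by rewrite divr_ge0// sqr_ge0.
- move=> t tab _; split => //; rewrite lee_fin.
  have := jm_factor_sqr m_gt0 h_ge0 (γ (clamp a b t)).
  have := sqr_ge0 (jm_factor m h (γ (clamp a b t)) - sp t).
  set f := jm_factor _ _ _; set U := newton_sum _ _; set v := sp t.
  move=> h1 h2; clear -h1 h2; nra.
Qed.

Lemma action_potential_reachable p q A :
  reachable m h p q A -> (action_potential m h p q <= A%:E)%E.
Proof.
move=> /(_ 0)[b [γ [b0 [γ0 γb] γC γO γA]]]; apply: le_trans γA.
apply: ereal_inf_lbound; exists b, γ; split => //.
exact: piecewise_C1_abs_continuous.
Qed.

Lemma jm_dist_reachable p q A :
  reachable m h p q A -> (jm_dist m h p q <= A%:E)%E.
Proof.
move=> /(_ 0)[b [γ [b0 γ0b γC γO γA]]]; apply: le_trans γA.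
apply: (@le_trans _ _ (jm_length m h γ `[0, b])); last first.
  by apply: jm_length_le_action => //; exact: piecewise_C1_abs_continuous.
by apply: ereal_inf_lbound; exists 0, b, γ; split.
Qed.

(** Standing still at [p] for a short time has arbitrarily small action, which bounds the length. *)
Lemma jm_distxx p : Omega p -> jm_dist m h p p = 0%E.
Proof.
move=> Op; apply/eqP; rewrite eq_le; apply/andP; split; last first.
  apply: le_ereal_inf_tmp => _ [a [b [γ [_ _ _ _ ->]]]].
  by apply: integral_ge0 => u _; rewrite lee_fin sqrtr_ge0.
apply/lee_addgt0Pr => e e0; rewrite add0e; apply: jm_dist_reachable.
apply: (@reachable_segment _ _ _ m h m_gt0 h_ge0 p p (jm_factor m h p + 1)).
- by rewrite ltr_wpDl// jm_factor_ge0.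
- by move=> s _; rewrite subrr scaler0 addr0 lerDl.
- by rewrite subrr -(scale0r p) mass_normZ normr0 mul0r mulr0.
Qed.

(** The potential is continuous and positive along the curve, so it has a positive minimum on
    [[a, b]]. Since length equals action for a minimizer, this will make its arclength strictly
    increasing. *)
Lemma action_gt0 (γ : R -> 'M[R]_(N, d)) (a b : R) : (2 <= N)%N -> a < b ->
  abs_continuous γ a b -> (forall t, a <= t <= b -> Omega (γ t)) ->
  (0 < action m h γ a b)%E.
Proof.
move=> N2 ab acγ Oγ; have ab' := ltW ab.
have [sp [_ _ aE _ _]] := curve_representation m_gt0 h_ge0 ab acγ Oγ.
pose U u := newton_sum m (γ (clamp a b u)).
have Ocl u : Omega (γ (clamp a b u)) by apply: Oγ; exact: clamp_in.
have cU : {within `[a, b], continuous U}.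
  apply: continuous_subspaceT => u.
  apply: (@continuous_comp _ _ _ (γ \o clamp a b)).
    exact: (abs_continuous_clamp ab' acγ).
  by apply: newton_sum_continuous; exact: Ocl.
have [c _ Uc] := EVT_min ab' cU.
have Uc0 : 0 < U c by exact: newton_sum_gt0.
apply: (@lt_le_trans _ _ (U c * (b - a))%:E).
  by rewrite lte_fin mulr_gt0// subr_gt0.
have -> : ((U c * (b - a))%:E = \int[leb]_(u in `[a, b]) (U c)%:E)%E.
  by rewrite integral_cst// [X in (_ * X)%E](lebesgue_itvcc ab').
have v0 u : 0 <= sp u ^+ 2 / 2 by rewrite divr_ge0// sqr_ge0.
rewrite aE ?lexx//; apply: (ge0_le_integral_null measurable0) => //.
- by move=> u _; rewrite lee_fin ltW.
- by move=> u _; rewrite lee_fin addr_ge0// addr_ge0 ?newton_sum_ge0.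
- move=> u uab _; split => //; rewrite lee_fin -addrA addrCA.
  by rewrite (le_trans (Uc u uab))// lerDl addr_ge0.
Qed.

(** A competitor of length [l'], run in either direction, yields paths from [p] to [q] of action at
    most [l' + e]. Hence both distances are bounded below by the same information, without proving
    [jm_dist] symmetric. *)
Lemma jm_dist_ge p q (l : R) : (forall A, reachable m h p q A -> l <= A) ->
  (l%:E <= jm_dist m h p q)%E /\ (l%:E <= jm_dist m h q p)%E.
Proof.
move=> lA; split; apply: le_ereal_inf_tmp => _ [a [b [γ [ab [γa γb] γC γO ->]]]];
  have [l' -> l'r] :=
    curve_reachable m_gt0 h_ge0 ab (piecewise_C1_abs_continuous γC) γO;
  rewrite lee_fin; apply/ler_addgt0Pr => e e0; apply: lA; rewrite -γa -γb;
  by have [] := l'r e e0.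
Qed.

Lemma minimizer_length (x : R -> 'M[R]_(N, d)) (a b : R) :
  free_time_minimizer m h x -> 0 <= a -> a < b ->
  exists l : R, [/\ jm_length m h x `[a, b] = l%:E, action m h x a b = l%:E,
    jm_dist m h (x a) (x b) = l%:E & jm_dist m h (x b) (x a) = l%:E].
Proof.
move=> [[xO xac] xmin] a0 ab; have ab' := ltW ab.
have xO' t : a <= t <= b -> Omega (x t).
  by move=> /andP[at_ _]; apply: xO; exact: le_trans at_.
have [l lE lr] := curve_reachable m_gt0 h_ge0 ab (xac a b a0 ab') xO'.
have pot_le : (action_potential m h (x a) (x b) <= l%:E)%E.
  apply/lee_addgt0Pr => e e0; rewrite -EFinD.
  by apply: action_potential_reachable; have [] := lr e e0.
have aE : action m h x a b = l%:E.
  apply/eqP; rewrite eq_le {1}xmin// pot_le/= -lE.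
  exact: jm_length_le_action (xac a b a0 ab') xO'.
have potE : action_potential m h (x a) (x b) = l%:E by rewrite -xmin.
have dist_le (u v : 'M[R]_(N, d)) : (forall e, 0 < e -> reachable m h u v (l + e)) ->
    (jm_dist m h u v <= l%:E)%E.
  move=> r; apply/lee_addgt0Pr => e e0; rewrite -EFinD.
  by apply: jm_dist_reachable; exact: r.
(* Here minimality enters the lower bound on the distance: [l] is the infimum of the action. *)
have l_le A : reachable m h (x a) (x b) A -> l <= A.
  by move=> /action_potential_reachable; rewrite potE lee_fin.
have [le1 le2] := jm_dist_ge l_le.
exists l; split => //; apply/eqP; rewrite eq_le ?le1 ?le2 andbT; apply: dist_le => e e0;
  by have [] := lr e e0.
Qed.

(** Each entry of [y - y0] is at most its mass norm divided by the root of the mass. The summand 1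
    in the witness for [D] keeps it positive, as it will occur in a denominator. *)
Lemma dist_ij_affine_bound (y0 : 'M[R]_(N, d)) (i j : 'I_N) :
  exists D C : R, [/\ 0 < D, 0 <= C &
    forall y, dist_ij y i j <= D + C * mass_norm m (y - y0)].
Proof.
have enorm_le (e : 'rV[R]_d) : enorm e <= \sum_(k < d) `|e 0 k|.
  set s := \sum_(k < d) _; have s0 : 0 <= s by exact: sumr_ge0.
  rewrite -[leRHS]ger0_norm// -sqrtr_sqr ler_wsqrtr// /dotp /s expr2 mulr_suml.
  apply: ler_sum => k _; rewrite -expr2 -real_normK ?num_real// expr2 ler_wpM2l//.
  by rewrite (bigD1 k)//= lerDl sumr_ge0.
pose S i := (Num.sqrt (m i))^-1.
have S0 k : 0 <= S k by rewrite invr_ge0 sqrtr_ge0.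
have entry y k l : `|(y - y0) k l| <= S k * mass_norm m (y - y0).
  by rewrite ler_pdivlMl ?sqrtr_gt0// mass_norm_entry.
exists (\sum_(k < d) `|y0 i k - y0 j k| + 1), (\sum_(k < d) (S i + S j)); split.
- by rewrite ltr_wpDl// sumr_ge0.
- by rewrite sumr_ge0// => k _; rewrite addr_ge0.
- move=> y; rewrite (le_trans (enorm_le _))// addrAC ler_wpDr// mulr_suml -big_split/=.
  apply: ler_sum => k _; rewrite !mxE.
  have := entry y i k; have := entry y j k; rewrite !mxE => yj yi.
  rewrite mulrDl; apply: le_trans (lerD (lexx _) (lerD yi yj)).
  have -> : y i k - y j k = y0 i k - y0 j k + ((y i k - y0 i k) - (y j k - y0 j k)) by ring.
  by rewrite (le_trans (ler_normD _ _))// lerD2l ler_normB.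
Qed.

(* If the length, hence the action, stayed bounded by M, then
   v <= sqrt T v^2 / 2 + 1 / (2 sqrt T) would give |x(s) - x(0)| = O(sqrt T) for
   s <= T, hence U >= c / sqrt T on [0, T] and an action of order sqrt T. *)
Lemma minimizer_length_unbounded (x : R -> 'M[R]_(N, d)) (M : R) :
  (2 <= N)%N -> free_time_minimizer m h x ->
  ~ (forall t : R, 0 < t -> (jm_length m h x `[0%R, t] <= M%:E)%E).
Proof.
move=> N2 xmin lM; have [[xO xac] _] := xmin.
pose i := Ordinal (ltnW N2); pose j := Ordinal N2.
have [D [C [D0 C0 DC]]] := dist_ij_affine_bound (x 0) i j.
pose μ := m i * m j; have μ0 : 0 < μ by rewrite mulr_gt0.
have M0 : 0 <= M.
  by rewrite -lee_fin (le_trans _ (lM 1 ltr01))// integral_ge0// => t _;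
    rewrite lee_fin sqrtr_ge0.
(* The integral of [c * Φ + 1 / (2 * c)] over [[0, c ^+ 2]] is [c * l + c / 2], at most [c * B]. *)
pose B := M + 1 / 2; have B0 : 0 <= B by rewrite addr_ge0.
have main (n : nat) : (0 < n)%N -> n%:R ^+ 2 * μ <= M * (D + C * (n%:R * B)).
  (* Taking [T] to be the square of an integer gives [c] as its root, and large [n] reach
     arbitrarily long times. *)
  move=> n0; pose c : R := n%:R; pose T := c ^+ 2.
  have c0 : 0 < c by rewrite ltr0n.
  have T0 : 0 < T by rewrite exprn_gt0.
  have T0' := ltW T0.
  have xO' t : 0 <= t <= T -> Omega (x t) by move=> /andP[t0 _]; exact: xO.
  have [sp [sp0 isp aE _ xle]] :=
    curve_representation m_gt0 h_ge0 T0 (xac 0 T (lexx _) T0') xO'.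
  have [l [lE lA _ _]] := minimizer_length xmin (lexx 0) T0.
  have lM' : l <= M by rewrite -lee_fin -lE lM.
  pose U u := newton_sum m (x (clamp 0 T u)).
  pose Φ u := sp u ^+ 2 / 2 + U u + h.
  have U0 u : 0 <= U u by exact: newton_sum_ge0.
  have v0 u : 0 <= sp u ^+ 2 / 2 by rewrite divr_ge0// sqr_ge0.
  have Φ0 u : 0 <= Φ u by rewrite addr_ge0// addr_ge0.
  have ΦE : (\int[leb]_(u in `[0%R, T]) (Φ u)%:E = l%:E)%E by rewrite -lA aE.
  have msp : measurable_fun setT sp by have /measurable_int/measurable_EFinP := isp.
  have mU : measurable_fun setT U.
    apply: continuous_measurable_fun => u.
    apply: (@continuous_comp _ _ _ (x \o clamp 0 T)).
      exact: (abs_continuous_clamp T0' (xac 0 T (lexx _) T0')).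
    by apply: newton_sum_continuous; apply: xO'; exact: clamp_in.
  have mΦ : measurable_fun setT Φ.
    apply: measurable_funD => //; apply: measurable_funD => //.
    by apply: measurable_funM => //; exact: measurable_funX.
  have iΦ : leb.-integrable `[0, T] (EFin \o Φ).
    apply/integrableP; split; first by apply/measurable_EFinP; exact: measurable_funTS.
    under eq_integral do rewrite /= ger0_norm//.
    by rewrite ΦE ltry.
  have icst (r : R) : leb.-integrable `[0, T] (EFin \o cst r).
    apply: continuous_compact_integrable; first exact: segment_compact.
    by apply: continuous_subspaceT => u; exact: cvg_cst.
  have ispT : leb.-integrable `[0, T] (EFin \o sp) by apply: integrableS isp.
  have leb0T : fine (leb `[0, T]%classic) = T by rewrite lebesgue_itvcc// subr0.
  have ΦR : \int[leb]_(u in `[0, T]) Φ u = l by rewrite /Rintegral ΦE.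
  have spB : \int[leb]_(u in `[0, T]) sp u <= c * B.
    rewrite (@le_trans _ _ (\int[leb]_(u in `[0, T]) (c * Φ u + (2 * c)^-1)))//.
      have iG : leb.-integrable `[0, T] (EFin \o (fun u => c * Φ u + (2 * c)^-1)).
        exact: (integrableD _ (integrableZl _ c iΦ) (icst (2 * c)^-1)).
      apply: le_Rintegral => //.
      move=> u _; have h1 := sqr_ge0 (c * sp u - 1).
      have h2 : 0 <= c * (U u + h) by rewrite mulr_ge0 ?addr_ge0// ltW.
      have cE : c * (2 * c)^-1 = 2^-1 by field; rewrite gt_eqF.
      rewrite -(ler_pM2l c0) mulrDr cE.
      have -> : c * (c * Φ u) = c ^+ 2 * sp u ^+ 2 / 2 + c * (c * (U u + h)).
        by rewrite /Φ; ring.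
      have h3 : 0 <= c * (c * (U u + h)) by rewrite mulr_ge0// ltW.
      have h4 : c * sp u <= c ^+ 2 * sp u ^+ 2 / 2 + 2^-1.
        by clear -h1; nra.
      by clear -h3 h4; lra.
    rewrite RintegralD//; [|exact: (integrableZl _ c iΦ)|exact: (icst (2 * c)^-1)].
    rewrite RintegralZl// Rintegral_cst// leb0T ΦR /B.
    have -> : (2 * c)^-1 * T = c / 2 by rewrite /T; field; rewrite gt_eqF.
    rewrite mulrDr mul1r lerD2r ler_pM2l//.
  have distB s : 0 <= s <= T -> dist_ij (x s) i j <= D + C * (c * B).
    move=> /andP[s0 sT]; rewrite (le_trans (DC _))// lerD2l ler_wpM2l//.
    rewrite (le_trans (xle 0 s (lexx _) s0 sT))// (le_trans _ spB)//.
    rewrite -lee_fin /Rintegral !fineK; last 2 first.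
    - exact: (integrable_fin_num _ ispT).
    - by apply: integrable_fin_num => //; apply: integrableS isp.
    apply: (ge0_le_integral_null measurable0) => //.
    - by move=> u _; rewrite lee_fin.
    - by move=> u _; rewrite lee_fin.
    - move=> u; rewrite /= !in_itv/= => /andP[u0 us] _; split => //.
      by rewrite u0 (le_trans us sT).
  have E0 : 0 < D + C * (c * B) by rewrite ltr_wpDr// mulr_ge0// mulr_ge0// ltW.
  have ΦU u : u \in `[0, T]%R -> μ / (D + C * (c * B)) <= Φ u.
    rewrite in_itv/= => uT; rewrite (@le_trans _ _ (U u))//; last first.
      by rewrite /Φ -addrA addrCA lerDl addr_ge0.
    rewrite /U clamp_id//; apply: le_trans (@newton_sum_ge_pair _ _ _ m m_gt0 _ i j _) => //.
    rewrite ler_pM2l// lef_pV2 ?posrE ?distB//.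
    have /OmegaP Oxu := xO' u uT; exact: (Oxu i j).
  have : T * (μ / (D + C * (c * B))) <= M.
    rewrite (le_trans _ lM')// -ΦR mulrC -[X in _ * X]leb0T -Rintegral_cst//.
    by apply: le_Rintegral => //; exact: icst.
  by rewrite mulrA ler_pdivrMr.
(* For [n >= 1], [main] implies [n * μ <= M * (D + C * B)], which the Archimedean property
   refutes. *)
have [n nP] : exists n : nat, M * (D + C * B) / μ < n.+1%:R.
  exists (Num.bound (M * (D + C * B) / μ)); apply: (lt_trans (archi_boundP _)).
    by rewrite divr_ge0 ?mulr_ge0 ?addr_ge0 ?mulr_ge0// ltW.
  by rewrite ltr_nat.
have n1 : 1 <= n.+1%:R :> R by rewrite ler1n.
have := main n.+1 isT; rewrite ltr_pdivrMr// in nP.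
set c := n.+1%:R in nP n1 * => hc.
have h1 : c * (M * (D + C * B)) < c * (c * μ) by rewrite ltr_pM2l// (lt_le_trans ltr01).
have h2 : M * D <= c * (M * D) by rewrite ler_peMl// mulr_ge0// ltW.
have h3 : c ^+ 2 * μ = c * (c * μ) by ring.
have h4 : M * (D + C * (c * B)) = M * D + c * (M * (C * B)) by ring.
have h5 : c * (M * (D + C * B)) = c * (M * D) + c * (M * (C * B)) by ring.
clear -hc h1 h2 h3 h4 h5; lra.
Qed.

End minimizer.

Theorem corollary4 (R : realType) (d N : nat) (m : 'I_N -> R) (h : R)
    (x : R -> 'M[R]_(N, d)) :
  (2 <= N)%N -> (forall i, 0 < m i) -> 0 <= h ->
  free_time_minimizer m h x -> center_of_mass_at_rest m x ->
  geodesic_ray m h x.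
Proof.
move=> N2 m_gt0 h_ge0 xmin _; have [[xO xac] _] := xmin.
pose ℓ := arclength m h x.
have len00 : jm_length m h x `[0%R, 0%R] = 0%E.
  by rewrite /jm_length set_itv1 integral_set1.
have lenE t : 0 <= t -> jm_length m h x `[0%R, t] = (ℓ t)%:E.
  rewrite le_eqVlt => /predU1P[<-|t0]; first by rewrite /ℓ /arclength len00.
  have [l [lE _ _ _]] := minimizer_length m_gt0 h_ge0 xmin (lexx 0) t0.
  by rewrite /ℓ /arclength lE.
have ℓ0 : ℓ 0 = 0 by rewrite /ℓ /arclength len00.
have xO' b t : 0 <= t <= b -> Omega (x t) by move=> /andP[t0 _]; exact: xO.
(* One integrable density on all of [[0, b]] yields both additivity and continuity of the arclength
   [ℓ]. *)
have ℓ_rep b : 0 < b -> exists2 f : R -> R,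
    lebesgue_measure.-integrable `[0, b] (EFin \o f) &
    (forall s t, 0 <= s -> s <= t -> t <= b -> jm_length m h x `[s, t] =
      (\int[lebesgue_measure]_(u in `[s, t]) (f u)%:E)%E) /\
    (forall u, 0 <= f u).
  move=> b0; have b0' := ltW b0.
  have acx := xac 0 b (lexx _) b0'.
  have [sp [sp0 isp _ lE _]] :=
    curve_representation m_gt0 h_ge0 b0 acx (xO' b).
  exists (fun u => jm_factor m h (x (clamp 0 b u)) * sp u).
    apply: integrable_continuousM => // u.
    apply: (@continuous_comp _ _ _ (x \o clamp 0 b)).
      exact: (abs_continuous_clamp b0' acx).
    by apply: jm_factor_continuous; apply: (xO' b); exact: clamp_in.
  by split => // u; rewrite mulr_ge0// jm_factor_ge0.
have ℓ_split s t : 0 <= s -> s < t ->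
    jm_length m h x `[s, t] = (ℓ t - ℓ s)%:E.
  move=> s0 st; have t0 := le_lt_trans s0 st; have st' := ltW st.
  have [f intf [fE f0]] := ℓ_rep t t0.
  have [l [lE _ _ _]] := minimizer_length m_gt0 h_ge0 xmin s0 st.
  have : (jm_length m h x `[0%R, t] =
      jm_length m h x `[0%R, s] + jm_length m h x `[s, t])%E.
    rewrite (fE 0 t)// ?(ltW t0)// (fE 0 s)// (fE s t)//.
    apply: ge0_integral_itv_split => //; first exact: (measurable_int _ intf).
    by move=> u _; rewrite lee_fin.
  rewrite !lenE ?(ltW t0)// lE -EFinD => -[->].
  by rewrite addrC addKr.
have ℓ_lt s t : 0 <= s -> s < t -> ℓ s < ℓ t.
  move=> s0 st; rewrite -subr_gt0 -lte_fin -ℓ_split//.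
  have [l [-> lA _ _]] := minimizer_length m_gt0 h_ge0 xmin s0 st.
  have acx := xac s t s0 (ltW st).
  have xOst u : s <= u <= t -> Omega (x u).
    by move=> /andP[su _]; apply: xO; exact: le_trans su.
  by have := action_gt0 m_gt0 h_ge0 N2 st acx xOst; rewrite lA.
have ℓ_dist s t : 0 <= s -> 0 <= t -> jm_dist m h (x s) (x t) = `|ℓ s - ℓ t|%:E.
  move=> s0 t0; have [st|ts|<-] := ltgtP s t.
  - have [l [lE _ -> _]] := minimizer_length m_gt0 h_ge0 xmin s0 st.
    rewrite distrC gtr0_norm ?subr_gt0 ?ℓ_lt//.
    by rewrite -(ℓ_split s t).
  - have [l [lE _ _ ->]] := minimizer_length m_gt0 h_ge0 xmin t0 ts.
    rewrite gtr0_norm ?subr_gt0 ?ℓ_lt//.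
    by rewrite -(ℓ_split t s).
  - by rewrite subrr normr0 jm_distxx//; exact: xO.
have ℓ_unbounded M : exists2 t, 0 < t & M < ℓ t.
  apply: contrapT => nM; apply: (minimizer_length_unbounded m_gt0 h_ge0 N2 xmin (M := M)).
  move=> t t0; rewrite lenE ?(ltW t0)// lee_fin leNgt; apply/negP => Mt.
  by apply: nM; exists t.
(* Continuity, [ℓ 0 = 0] and unboundedness give surjectivity by the intermediate value theorem. *)
have ℓ_onto s : 0 <= s -> exists t, 0 <= t /\ ℓ t = s.
  move=> s0; have [b b0 sb] := ℓ_unbounded s; have b0' := ltW b0.
  have [f intf [fE f0]] := ℓ_rep b b0.
  have cℓ : {within `[0, b], continuous ℓ}.
    have := parameterized_integral_continuous b0' intf.
    apply: subspace_eq_continuous => t; rewrite inE/= in_itv/= => /andP[t0 tb].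
    have e := lenE t t0; rewrite (fE 0 t)// in e.
    exact: (f_equal fine e).
  have [t tb <-] : exists2 t, t \in `[0, b]%R & ℓ t = s.
    apply: IVT => //.
    by rewrite ℓ0 min_l ?max_r ?s0 ?ltW// -ℓ0; exact: ℓ_lt.
  by exists t; split => //; move: tb; rewrite in_itv/= => /andP[].
have ℓ_inj s t : 0 <= s -> 0 <= t -> ℓ s = ℓ t -> s = t.
  move=> s0 t0 st; have [/(ℓ_lt _ _ s0)|/(ℓ_lt _ _ t0)|//] := ltgtP s t;
    by rewrite st ltxx.
(* The inverse of [ℓ], so that [x \o τ] is the arclength parameterization; the default 0 occurs only
   for negative [s]. *)
pose τ s := xget 0 [set t | 0 <= t /\ ℓ t = s].
have τP s : 0 <= s -> 0 <= τ s /\ ℓ (τ s) = s.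
  by move=> s0; have /(xgetPex 0) := ℓ_onto s s0.
split => //.
- by move=> t t0; rewrite lenE// ltry.
- apply: eq_infty => M.
  have [t t0 Mt] := ℓ_unbounded M; have t0' := ltW t0.
  rewrite (@le_trans _ _ (ℓ t)%:E) ?lee_fin ?(ltW Mt)// -lenE// /jm_length.
  (* Enlarging the domain of integration in this way asks for no measurability of [derive1 x]. *)
  apply: (ge0_le_integral_null measurable0) => //.
  by move=> u; rewrite /= !in_itv/= => /andP[-> _].
- exists (x \o τ); split => /=.
  + move=> t t0; have ℓt0 : 0 <= ℓ t.
      by move: t0; rewrite le_eqVlt => /predU1P[<-|/(ℓ_lt _ _ (lexx 0))/ltW]; rewrite ℓ0.
    have [h1 h2] := τP _ ℓt0; congr x; exact: ℓ_inj.
  + by move=> s s0; apply: xO; have [] := τP s s0.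
  + move=> s s' s0 s0'; have [h1 h2] := τP s s0; have [h3 h4] := τP s' s0'.
    by rewrite ℓ_dist// h2 h4.
Qed.
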